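(* Assume $n\geq 4$ is even, $-n<a<+\infty$, $1<p<+\infty$, and let $u\in C^{n}(\mathbb{R}^{n}_{+})\cap C^{n-2}(\overline{\mathbb{R}^{n}_{+}})$ be a nonnegative solution of $$\begin{cases}(-\Delta)^{\frac{n}{2}}u(x)=|x|^{a}u^{p}(x),\quad u(x)\geq 0, & x\in\mathbb{R}^{n}_{+},\\ u=(-\Delta)u=\cdots=(-\Delta)^{\frac{n}{2}-1}u=0 & \text{on }\partial\mathbb{R}^{n}_{+}.\end{cases}$$ If one of the following two assumptions holds: $$a\geq -2p-2\qquad\text{or}\qquad u(x)=o(|x|^{2})\ \text{ as } |x|\to+\infty,$$ then $$(-\Delta)^{i}u(x)\geq 0$$ for every $i=1,2,\dots,\frac{n}{2}-1$ and all $x\in\overline{\mathbb{R}^{n}_{+}}$.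
   Context: $\mathbb{R}^{n}_{+}=\{x=(x_{1},\dots,x_{n})\in\mathbb{R}^{n}: x_{n}>0\}$ is the upper half space. For an integer $k$, $(-\Delta)^{k}$ is the $k$-fold iterate of $-\Delta$. *)

(* Defs.v *)
From HB Require Import structures.
From mathcomp Require Import all_boot all_order all_algebra.
From mathcomp Require Import all_classical all_reals all_analysis.

Set Implicit Arguments.
Unset Strict Implicit.
Unset Printing Implicit Defensive.

Import Order.TTheory GRing.Theory Num.Theory.
Import numFieldNormedType.Exports.

Local Open Scope classical_set_scope.
Local Open Scope ring_scope.

Section Defs.
Context {R : realType}.

(* The library norm `|x| on 'rV[R]_n is the sup norm. *)
Definition enorm n (x : 'rV[R]_n) : R := Num.sqrt (\sum_(i < n) x 0 i ^+ 2).

(* The last coordinate of x is the x 0 i with i.+1 = n. *)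
Definition upper_half_space n : set 'rV[R]_n :=
  [set x | forall i : 'I_n, i.+1 = n -> 0 < x 0 i].

Definition boundary n (U : set 'rV[R]_n) : set 'rV[R]_n :=
  closure U `\` U°.

Definition partial n (i : 'I_n) (f : 'rV[R]_n -> R) : 'rV[R]_n -> R :=
  fun x => 'D_(delta_mx 0 i) f x.

Definition partials n (s : seq 'I_n) (f : 'rV[R]_n -> R) : 'rV[R]_n -> R :=
  foldr (@partial n) f s.

Definition neg_laplacian n (f : 'rV[R]_n -> R) : 'rV[R]_n -> R :=
  fun x => - \sum_(i < n) partials [:: i; i] f x.

(* C^k(U), for U open *)
Definition Ck n (k : nat) (U : set 'rV[R]_n) (f : 'rV[R]_n -> R) : Prop :=
  (forall (s : seq 'I_n) (i : 'I_n) x, (size s < k)%N -> U x ->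
     derivable (partials s f) x (delta_mx 0 i)) /\
  (forall (s : seq 'I_n) x, (size s <= k)%N -> U x ->
     {for x, continuous (partials s f)}).

(* C^k of the closure of U, for U open: f is continuous on the closure, is C^k
   in U, and its partial derivatives of order at most k extend continuously
   from U to the closure. *)
Definition Ck_closure n (k : nat) (U : set 'rV[R]_n) (f : 'rV[R]_n -> R) :
    Prop :=
  [/\ {within closure U, continuous f},
      Ck k U f &
      forall s : seq 'I_n, (size s <= k)%N ->
        exists g : 'rV[R]_n -> R,
          {within closure U, continuous g} /\ {in U, g =1 partials s f}].

(* The value on the closure of U of a function g which is only meaningful in U
   (the partial derivatives at a boundary point would involve the values of the
   function outside of the closure): g itself in U, and the limit from inside U
   at the points of the boundary. *)
Definition closure_ext n (U : set 'rV[R]_n) (g : 'rV[R]_n -> R) :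
    'rV[R]_n -> R :=
  fun x => if x \in U then g x else lim (g y @[y --> within U (nbhs x)]).

Definition at_infinity n : set_system 'rV[R]_n :=
  filter_from setT (fun M : R => [set x | M < enorm x]).

Global Instance at_infinity_filter n : Filter (@at_infinity n).
Proof.
apply: filter_from_filter; first by exists 0.
move=> M N _ _; exists (Num.max M N) => // x /=.
by rewrite gt_max => /andP[].
Qed.

Canonical at_infinity_filter_on n :=
  FilterType (@at_infinity n) (@at_infinity_filter n).

End Defs.

Arguments upper_half_space R n : clear implicits.
Arguments at_infinity R n : clear implicits.

(* Main.v *)
(* Write m = n/2, w_i = (-Delta)^i u, and for a point c of the half space with mirror
   image c' let K_{s,k}(x) = (s - |x - c|^2)_+^k - (s - |x - c'|^2)_+^k, which is
   nonnegative in the half space, odd across its boundary and compactly supported. As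
   Delta K_{s,k} = 4 k ((k-1) s K_{s,k-2} - (k-1+m) K_{s,k-1}), Green's formula shows that
   b_i(s) = s^(-m-k-i) int w_i K_{s,k+i} satisfies b_i' = - c_i b_{i+1} with c_i > 0, and
   b_(m-1)' <= 0: this is the heat semigroup argument, with compactly supported kernels.
   Testing the equation itself against K_{s,k} and absorbing by Young's inequality (here
   a > -n and p > 1 are used) bounds b_0 as s tends to infinity. If some b_i with i >= 1
   were negative somewhere, it would be so near infinity, and integrating the chain down
   to b_0 would make b_0 unbounded. So b_i >= 0, and letting s tend to 0 gives
   w_i(c) >= 0.

   Integrals are limits, along a fixed ultrafilter, of Riemann sums over finer and finer
   grids: only positivity, linearity, the vanishing of the integral of a derivative, and
   the volume of boxes, slabs and small cubes are ever needed. *)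

(* The power s^(m+k) is, up to a constant, the mass of (s - |x - c|^2)_+^k in dimension n = 2m.
   Dividing by it turns the s-derivative of a mean into a multiple of the very combination of
   K_{s,k} and K_{s,k-1} that makes up Delta K_{s,k+1}; the scale s then plays the part of time in
   the heat equation.

   That b_0 stays bounded reflects the critical order n of the operator. The Laplacians turn
   K_{s,k+2m} into kernels of size s^m K_{s,k}, the weight |x|^a is at least of order s^(-m) on the
   support away from the origin because a > -n, and the support has volume of order s^m. Absorption
   then leaves int u K_{s,k} = O(s^(k+m)), exactly the power by which b_0 is divided.

   The obstacle is the boundary: |x|^a u^p is not known to be bounded near it, in particular near
   the origin when a < 0. Green's formula is therefore stated as an inequality for a bounded
   minorant of w_{i+1} K; below the top order, using it for both w_i and -w_i gives equality.
   Exponents start at 3 because t_+^3 is the first truncated power of class C^2. *)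
Require Import Defs.
From HB Require Import structures.
From mathcomp Require Import all_boot all_order all_algebra.
From mathcomp Require Import ring lra zify.
From mathcomp Require Import all_classical all_reals all_analysis.
Import Order.TTheory GRing.Theory Num.Theory.
Import numFieldNormedType.Exports.
Local Open Scope classical_set_scope.
Local Open Scope ring_scope.

Set Implicit Arguments.
Unset Strict Implicit.
Unset Printing Implicit Defensive.

(** * Riemann sums over a grid *)

Section GridSum.
Context {R : realType} {n : nat}.
Implicit Types (f g : 'rV[R]_n -> R) (N k : nat).

Definition mesh N : R := N.+1%:R^-1.

(** One parameter drives two limits: the step is 1/(N+1) and the nodes fill [-(N+1), N+1) in each
    coordinate, so the mesh shrinks while every bounded support ends up inside the grid. *)
Definition node N k : R := k%:R * mesh N - N.+1%:R.

Definition gsize N : nat := (N.+1 * N.+1).*2.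

Definition gpoint N (k : {ffun 'I_n -> 'I_(gsize N)}) : 'rV[R]_n :=
  \row_j node N (k j).

Definition gsum N f : R := mesh N ^+ n * \sum_k f (@gpoint N k).

Lemma mesh_gt0 N : 0 < mesh N.
Proof. by rewrite invr_gt0 ltr0n. Qed.

Lemma mesh_ge0 N : 0 <= mesh N.
Proof. exact/ltW/mesh_gt0. Qed.

Lemma mesh_le1 N : mesh N <= 1.
Proof. by rewrite invf_le1 ?ler1n// ltr0n. Qed.

Lemma nodeS N k : node N k.+1 = node N k + mesh N.
Proof. by rewrite /node -natr1 mulrDl mul1r addrAC. Qed.

Lemma node0 N : node N 0 = - N.+1%:R.
Proof. by rewrite /node mul0r add0r. Qed.

Lemma node_gsize N : node N (gsize N) = N.+1%:R.
Proof.
rewrite /node /gsize -addnn natrD natrM /mesh mulrDl.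
by rewrite -!mulrA mulfV ?pnatr_eq0// mulr1 addrK.
Qed.

Lemma gsumD N f g : gsum N (fun x => f x + g x) = gsum N f + gsum N g.
Proof. by rewrite /gsum big_split mulrDr. Qed.

Lemma gsumZ N c f : gsum N (fun x => c * f x) = c * gsum N f.
Proof. by rewrite /gsum -mulr_sumr mulrCA. Qed.

Lemma gsum_le N f g : (forall x, f x <= g x) -> gsum N f <= gsum N g.
Proof.
by move=> fg; rewrite ler_wpM2l ?exprn_ge0 ?mesh_ge0//; apply: ler_sum.
Qed.

Lemma gsum_norm N f : `|gsum N f| <= gsum N (fun x => `|f x|).
Proof.
rewrite /gsum normrM ger0_norm ?exprn_ge0 ?mesh_ge0//.
by rewrite ler_wpM2l ?exprn_ge0 ?mesh_ge0// ler_norm_sum.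
Qed.

(** Distributivity over the product grid: volumes of boxes, slabs and cubes reduce to counting nodes
    in an interval. *)
Lemma gsum_prod N (g : 'I_n -> R -> R) :
  gsum N (fun x => \prod_j g j (x 0 j)) =
  \prod_j (mesh N * \sum_(k < gsize N) g j (node N k)).
Proof.
rewrite big_split /= prodr_const card_ord bigA_distr_bigA /=; congr (_ * _).
by apply: eq_bigr => k _; apply: eq_bigr => j _; rewrite mxE.
Qed.

Lemma telescope_nodes N (c : R -> R) :
  \sum_(k < gsize N) (c (node N k + mesh N) - c (node N k)) =
  c N.+1%:R - c (- N.+1%:R).
Proof.
rewrite -node0 -node_gsize -(telescope_sumr (fun k => c (node N k)))//.
by rewrite big_mkord; apply: eq_bigr => k _; rewrite nodeS.
Qed.

Definition ind (a b t : R) : R := (a <= t <= b)%R%:R.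

Lemma ind_ge0 a b t : 0 <= ind a b t.
Proof. exact: ler0n. Qed.

(* The clamp of t to an interval moves by at most the mesh between two nodes,
   and only over the interval: telescoping it counts the nodes there. *)
Definition clamp (a b t : R) : R := Num.max a (Num.min b t).

Local Ltac case_clamp :=
  repeat match goal with
  | |- context [nat_of_bool (?x <= ?y <= ?z)] =>
    case: (lerP x y) => ?; case: (lerP y z) => ? /=
  | |- context [Order.min ?x ?y] => case: (lerP x y) => ?
  | |- context [Order.max ?x (Order.min _ _)] => fail 1
  | |- context [Order.max ?x ?y] => case: (lerP x y) => ?
  end; lra.

(** Widening the interval by [h] makes every [t] in [a, b] move by the full step; the next lemma
    narrows it instead, so that only points of [a, b] move at all. *)
Lemma clamp_step_ge (a b t h : R) : 0 < h ->
  h * ind a b t <= clamp a (b + h) (t + h) - clamp a (b + h) t.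
Proof. by move=> h0; rewrite /ind /clamp; case_clamp. Qed.

Lemma clamp_step_le (a b t h : R) : 0 < h ->
  clamp (a + h) b (t + h) - clamp (a + h) b t <= h * ind a b t.
Proof. by move=> h0; rewrite /ind /clamp; case_clamp. Qed.

Lemma sum_ind_le N (a b : R) : a <= b ->
  mesh N * \sum_(k < gsize N) ind a b (node N k) <= b - a + mesh N.
Proof.
move=> ab; have h0 := mesh_gt0 N.
apply: (@le_trans _ _ (\sum_(k < gsize N)
  (clamp a (b + mesh N) (node N k + mesh N) - clamp a (b + mesh N) (node N k)))).
  by rewrite mulr_sumr; apply: ler_sum => k _; exact: clamp_step_ge.
by rewrite telescope_nodes /clamp; move: N.+1%:R => p; case_clamp.
Qed.

Lemma sum_ind_ge N (a b : R) : - N.+1%:R <= a -> b <= N.+1%:R ->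
  b - a - mesh N <= mesh N * \sum_(k < gsize N) ind a b (node N k).
Proof.
move=> aN bN; have h0 := mesh_gt0 N.
have [bah|bah] := lerP (b - a) (mesh N).
  apply: (@le_trans _ _ 0); first by lra.
  by rewrite mulr_ge0 ?mesh_ge0// sumr_ge0// => k _; exact: ind_ge0.
apply: (@le_trans _ _ (\sum_(k < gsize N)
  (clamp (a + mesh N) b (node N k + mesh N) - clamp (a + mesh N) b (node N k)))).
  by rewrite telescope_nodes /clamp; move: N.+1%:R aN bN => p; case_clamp.
by rewrite mulr_sumr; apply: ler_sum => k _; exact: clamp_step_le.
Qed.

Definition box_ind (L : R) (x : 'rV[R]_n) : R := \prod_j ind (- L) L (x 0 j).

Lemma box_ind_ge0 L x : 0 <= box_ind L x.
Proof. by apply: prodr_ge0 => j _; exact: ind_ge0. Qed.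

Lemma norm_coord (x : 'rV[R]_n) j : `|x 0 j| <= `|x|.
Proof.
rewrite [leRHS]/Num.norm /= mx_normrE.
by apply/bigmax_geP; right => /=; exists (0, j).
Qed.

Lemma box_ind1 L x : `|x| <= L -> box_ind L x = 1.
Proof.
move=> xL; rewrite /box_ind big1// => j _; rewrite /ind -ler_norml.
by rewrite (le_trans (norm_coord x j)).
Qed.

Lemma gsum_box_le N L : 0 <= L -> gsum N (box_ind L) <= (2 * L + 1) ^+ n.
Proof.
move=> L0; rewrite (gsum_prod N (fun=> ind (- L) L)).
rewrite -[n in _ ^+ n]card_ord -prodr_const; apply: ler_prod => j _.
apply/andP; split.
  by rewrite mulr_ge0 ?mesh_ge0// sumr_ge0// => k _; exact: ind_ge0.
have LL : - L <= L by lra.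
by rewrite (le_trans (sum_ind_le N LL))//; have := mesh_le1 N; lra.
Qed.

(* bbs: bounded with bounded support *)
Definition bbs f := exists C L : R,
  [/\ 0 <= C, 0 <= L, forall x, `|f x| <= C & forall x, L < `|x| -> f x = 0].

Lemma bbs_le_box f C L : (forall x, `|f x| <= C) ->
  (forall x, L < `|x| -> f x = 0) -> forall x, `|f x| <= C * box_ind L x.
Proof.
move=> fC fL x; have [xL|Lx] := lerP `|x| L; first by rewrite box_ind1// mulr1.
rewrite fL// normr0 mulr_ge0 ?box_ind_ge0//.
exact: le_trans (fC x).
Qed.

Lemma gsum_bbs f : bbs f -> exists C, forall N, `|gsum N f| <= C.
Proof.
move=> [C [L [C0 L0 fC fL]]]; exists (C * (2 * L + 1) ^+ n) => N.
rewrite (le_trans (gsum_norm _ _))//.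
rewrite (le_trans (gsum_le N (bbs_le_box fC fL)))// gsumZ.
by rewrite ler_wpM2l// gsum_box_le.
Qed.

(** The shift of the index is cyclic, so as to be a permutation of the grid; the wrap-around only
    concerns points where the functions at hand vanish. *)
Definition ffshift N (j : 'I_n) (k : {ffun 'I_n -> 'I_(gsize N)}) :=
  [ffun i => if i == j then ordS (k i) else k i].

Lemma ffshift_inj N j : injective (@ffshift N j).
Proof.
move=> k l kl; apply/ffunP => i; move/ffunP: kl => /(_ i); rewrite !ffunE.
by case: ifP => // _; exact: ordS_inj.
Qed.

Lemma gsum_shift N f j : (forall x, N.+1%:R <= `|x| -> f x = 0) ->
  gsum N (fun x => f (mesh N *: delta_mx 0 j + x)) = gsum N f.
Proof.
move=> f0; rewrite /gsum; congr (_ * _).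
rewrite [RHS](reindex_inj (@ffshift_inj N j)); apply: eq_bigr => k _ /=.
have [kj|] := ltnP (k j).+1 (gsize N).
  congr f; apply/rowP => i; rewrite !mxE ffunE eqxx /=.
  case: eqVneq => [->|_]; last by rewrite mulr0 add0r.
  by rewrite mulr1 /= modn_small// nodeS addrC.
move=> kj; have {}kj : (k j).+1 = gsize N by apply/eqP; rewrite eqn_leq kj andbT.
(* At the last index the two points have j-th coordinate N+1 and -(N+1), both outside the
   support. *)
rewrite !f0//.
  rewrite (le_trans _ (norm_coord _ j))// !mxE ffunE eqxx /= kj modnn node0.
  by rewrite normrN normr_nat.
rewrite (le_trans _ (norm_coord _ j))// !mxE !eqxx /= mulr1 addrC -nodeS kj.
by rewrite node_gsize normr_nat.
Qed.

End GridSum.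

(** * Directional derivatives along lines, and compactness of balls *)

Section LineDerivative.
Context {R : realType} {n : nat}.
Implicit Types (f : 'rV[R]_n -> R) (x v : 'rV[R]_n).

(** The two difference quotients are the same function of the increment. One-variable theorems thus
    apply to directional derivatives, without total differentiability. *)
Lemma is_derive_line f x v (t d : R) : is_derive (t *: v + x) v f d ->
  is_derive t 1 (fun t => f (t *: v + x)) d.
Proof.
move=> [fd <-]; suff E : (fun h : R => h^-1 *: ((fun t => f (t *: v + x)) (h *: 1 + t)
    - f (t *: v + x))) =
  (fun h : R => h^-1 *: (f (h *: v + (t *: v + x)) - f (t *: v + x))).
  by apply: DeriveDef; rewrite /derivable /derive /= E.
by apply/funext => h; rewrite [h *: 1]mulr1 scalerDl addrA.
Qed.

Lemma is_derive_line0 f x v d :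
  is_derive (0 : R) 1 (fun t => f (t *: v + x)) d -> is_derive x v f d.
Proof.
move=> [fd <-]; suff E : (fun h : R => h^-1 *: ((fun t => f (t *: v + x)) (h *: 1 + 0)
    - f (0 *: v + x))) =
  (fun h : R => h^-1 *: (f (h *: v + x) - f x)).
  by apply: DeriveDef; [move: fd|]; rewrite /derivable /derive /= E.
by apply/funext => h; rewrite [h *: 1]mulr1 addr0 scale0r add0r.
Qed.

Lemma line_MVT f (g : 'rV[R]_n -> R) x v (h : R) : 0 < h ->
  (forall x, is_derive x v f (g x)) ->
  exists2 t, t \in `]0, h[ & f (h *: v + x) - f x = g (t *: v + x) * h.
Proof.
move=> h0 fg.
have D (t : R) : is_derive t (1 : R) (fun t => f (t *: v + x)) (g (t *: v + x)).
  exact: is_derive_line.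
have [|t th] := @MVT _ _ (fun t => g (t *: v + x)) 0 h h0 (fun t _ => D t).
  apply: continuous_subspaceT => s; apply/differentiable_continuous.
  by apply/derivable1_diffP; have [] := D s.
by rewrite scale0r add0r subr0 => ?; exists t.
Qed.

End LineDerivative.

Lemma closed_norm_le (R : realType) (n : nat) (L : R) :
  closed [set x : 'rV[R]_n | `|x| <= L].
Proof.
rewrite (_ : mkset _ = (fun x : 'rV[R]_n => `|x|) @^-1` [set y | y <= L])//.
by apply: closed_comp => [x _|]; [exact: norm_continuous|exact: closed_le].
Qed.

Lemma compact_norm_le (R : realType) (n : nat) (L : R) :
  compact [set x : 'rV[R]_n | `|x| <= L].
Proof.
apply: bounded_closed_compact; last exact: closed_norm_le.
exists L; split; first exact: num_real.
by move=> M LM x /= xL; rewrite (le_trans xL)// ltW.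
Qed.

(** Each point of the ball has a radius r on which f varies by less than e/2; half of it serves the
    nearby points and half the displacement, and near-covering makes it uniform. The second point
    may leave the ball, as the grid steps of [mint_derive] do. *)
Lemma compact_unif_continuous (R : realType) (n : nat) (f : 'rV[R]_n -> R)
    (L e : R) : 0 < e ->
  {in [set x | `|x| <= L], continuous f} ->
  exists2 d, 0 < d & forall x y, `|x| <= L -> `|x - y| < d -> `|f x - f y| < e.
Proof.
move=> e0 cf.
have [|d /= d0 H] := (compact_near_coveringP _).1 (@compact_norm_le R n L) R 0^'+
  (fun d x => forall y, `|x - y| < d -> `|f x - f y| < e) _ _.
  move=> x /= xL.
  have /cvgrPdist_lt /(_ (e / 2)) := cf x (mem_set xL).
  rewrite divr_gt0// => /(_ isT) /nbhs_ballP[r /= r0 rf].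
  exists (ball x (r / 2), [set d | d < r / 2]).
    split; first by apply: nbhsx_ballx; rewrite divr_gt0.
    by apply: nbhs_right_lt; rewrite divr_gt0.
  move=> [y d] /= [xy dr] z yz.
  have fy : `|f x - f y| < e / 2.
    by apply: rf; apply: le_ball xy; lra.
  have fz : `|f x - f z| < e / 2.
    apply: rf; rewrite -ball_normE /=; move: xy; rewrite -ball_normE /= => xy.
    by rewrite (le_lt_trans (ler_distD y _ _))//; lra.
  by rewrite (le_lt_trans (ler_distD (f x) _ _))// [`|f y - _|]distrC; lra.
have d20 : 0 < d / 2 by rewrite divr_gt0.
exists (d / 2) => // x y xL; apply: (H (d / 2)) => //=.
by rewrite sub0r normrN gtr0_norm//; lra.
Qed.

(** Serves to push the ultrafilter on the integers to the real line, where compactness of a segment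
    gives every bounded sequence of Riemann sums a limit. *)
Lemma ultra_fmap (T U : Type) (f : T -> U) (F : set_system T) :
  UltraFilter F -> UltraFilter (f @ F).
Proof.
move=> FU; split; first exact: fmap_proper_filter.
move=> G GF sFG; rewrite predeqE => A; split; last exact: sFG.
move=> GA; have [//|FnA] := in_ultra_setVsetC (f @^-1` A) FU.
have [] := @filter_not_empty _ _ GF.
by rewrite -(setICr A); apply: filterI => //; exact: sFG.
Qed.

Lemma norm_le_coord (R : realType) (n : nat) (x : 'rV[R]_n) (L : R) : 0 <= L ->
  (forall j, `|x 0 j| <= L) -> `|x| <= L.
Proof.
move=> L0 xL; rewrite [leLHS]/Num.norm /= mx_normrE.
by apply: bigmax_le => //= -[i j] _ /=; rewrite ord1.
Qed.

(** * A positive functional integrating bounded functions of bounded support *)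

Section MeanIntegral.
Context {R : realType} {n : nat}.
Implicit Types (f g : 'rV[R]_n -> R) (N : nat).

Let ultra : {U : set_system nat | UltraFilter U /\ \oo `<=` U} :=
  cid (ultraFilterLemma _).

Definition grid_filter : set_system nat := sval ultra.

Local Instance grid_filter_ultra : UltraFilter grid_filter.
Proof. exact: (svalP ultra).1. Qed.

Lemma grid_filter_infty : \oo `<=` grid_filter.
Proof. exact: (svalP ultra).2. Qed.

(* The limit along an ultrafilter makes the integral a positive linear functional
   on all bounded functions with bounded support, measurable or not. *)
Definition mint f : R := lim (gsum N f @[N --> grid_filter]).

Lemma bbs_cvg f : bbs f -> cvg (gsum N f @[N --> grid_filter]).
Proof.
move=> /gsum_bbs[C fC]; have := @segment_compact R (- C) C.
rewrite compact_ultra => /(_ (gsum N f @[N --> grid_filter])).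
case.
- exact: ultra_fmap.
- apply: (@filterS _ grid_filter _ setT _ _ filterT) => N _.
  by rewrite /= in_itv /= -ler_norml.
- by move=> p [_ fp]; apply/cvg_ex; exists p.
Qed.

Lemma bbsD f g : bbs f -> bbs g -> bbs (fun x => f x + g x).
Proof.
move=> [C [L [C0 L0 fC fL]]] [D [M [D0 M0 gD gM]]].
exists (C + D), (Num.max L M); split; rewrite ?addr_ge0// ?le_max ?L0//.
  by move=> x; rewrite (le_trans (ler_normD _ _))// lerD ?fC ?gC.
by move=> x; rewrite gt_max => /andP[? ?]; rewrite fL// gM// addr0.
Qed.

Lemma bbs_dom f g : (forall x, `|f x| <= `|g x|) -> bbs g -> bbs f.
Proof.
move=> fg [C [L [C0 L0 gC gL]]]; exists C, L; split => // x.
  exact: le_trans (fg x) (gC x).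
by move=> /gL gx; apply/eqP; rewrite -normr_le0 (le_trans (fg x))// gx normr0.
Qed.

Lemma bbsZ c f : bbs f -> bbs (fun x => c * f x).
Proof.
move=> [C [L [C0 L0 fC fL]]]; exists (`|c| * C), L; split => //.
- by rewrite mulr_ge0.
- by move=> x; rewrite normrM ler_wpM2l ?fC.
- by move=> x /fL ->; rewrite mulr0.
Qed.

Lemma bbsN f : bbs f -> bbs (fun x => - f x).
Proof. by apply: bbs_dom => x; rewrite normrN. Qed.

Lemma bbsB f g : bbs f -> bbs g -> bbs (fun x => f x - g x).
Proof. by move=> fb /bbsN gb; exact: bbsD. Qed.

Lemma bbs_box L : 0 <= L -> bbs (@box_ind R n L).
Proof.
move=> L0; exists 1, L; split => // x.
  rewrite ger0_norm ?box_ind_ge0// prodr_ile1// => j _.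
  by rewrite ind_ge0 /ind lern1 leq_b1.
rewrite ltNge => xL; apply/eqP; apply: contraNT xL => /prodf_neq0 x0.
apply: norm_le_coord => // j; have := x0 j isT; rewrite /ind -ler_norml pnatr_eq0 eqb0.
by rewrite negbK.
Qed.

Lemma mintD f g : bbs f -> bbs g -> mint (fun x => f x + g x) = mint f + mint g.
Proof.
move=> /bbs_cvg fc /bbs_cvg gc; rewrite /mint -limD//.
rewrite (_ : gsum^~ _ = (gsum^~ f : nat -> R) + (gsum^~ g : nat -> R))//.
by apply/funext => N; exact: gsumD.
Qed.

Lemma mintZ c f : bbs f -> mint (fun x => c * f x) = c * mint f.
Proof.
move=> /bbs_cvg fc; rewrite /mint.
rewrite (_ : gsum^~ _ = c *: (gsum^~ f : nat -> R)); first exact: limZl_tmp.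
by apply/funext => N; exact: gsumZ.
Qed.

Lemma mintN f : bbs f -> mint (fun x => - f x) = - mint f.
Proof.
move=> fb; rewrite -mulN1r -mintZ//; congr mint.
by apply/funext => x; rewrite mulN1r.
Qed.

Lemma mintB f g : bbs f -> bbs g -> mint (fun x => f x - g x) = mint f - mint g.
Proof. by move=> fb gb; rewrite mintD ?mintN//; exact: bbsN. Qed.

Lemma mint_ge_near f c : bbs f -> (\forall N \near \oo, c <= gsum N f) ->
  c <= mint f.
Proof. by move=> /bbs_cvg fc cf; apply: limr_ge => //; exact: grid_filter_infty. Qed.

Lemma mint_le_near f c : bbs f -> (\forall N \near \oo, gsum N f <= c) ->
  mint f <= c.
Proof. by move=> /bbs_cvg fc cf; apply: limr_le => //; exact: grid_filter_infty. Qed.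

Lemma gsum0 N : gsum N ((fun=> 0) : 'rV[R]_n -> R) = 0.
Proof. by rewrite /gsum big1 ?mulr0. Qed.

Lemma mint_ge0 f : bbs f -> (forall x, 0 <= f x) -> 0 <= mint f.
Proof.
move=> fb f0; apply: mint_ge_near => //; apply: nearW => N.
by rewrite -(gsum0 N); exact: gsum_le.
Qed.

Lemma mint_le f g : bbs f -> bbs g -> (forall x, f x <= g x) -> mint f <= mint g.
Proof.
move=> fb gb fg; rewrite -subr_ge0 -mintB//; apply: mint_ge0; first exact: bbsB.
by move=> x; rewrite subr_ge0.
Qed.

Lemma mint_norm_le f g : bbs f -> bbs g -> (forall x, `|f x| <= g x) ->
  `|mint f| <= mint g.
Proof.
move=> fb gb fg; rewrite ler_norml -mintN//.
apply/andP; split; apply: mint_le => //; try exact: bbsN.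
  by move=> x; have := fg x; rewrite ler_norml => /andP[].
by move=> x; have := fg x; rewrite ler_norml => /andP[].
Qed.

Lemma mint_box_le L : 0 <= L -> mint (@box_ind R n L) <= (2 * L + 1) ^+ n.
Proof.
move=> L0; apply: mint_le_near; first exact: bbs_box.
by apply: nearW => N; exact: gsum_box_le.
Qed.

Lemma near_mesh (e : R) : 0 < e -> \forall N \near \oo, mesh N <= e.
Proof.
move=> e0; have := near_infty_natSinv_lt (PosNum e0).
by apply: filterS => N /ltW.
Qed.

Lemma near_size (L : R) : \forall N \near \oo, L <= N.+1%:R.
Proof.
have := nbhs_infty_ger L; apply: filterS => N /= /le_trans; apply.
by rewrite ler_nat.
Qed.

(** The difference quotient of F along the mesh has grid sum 0 by shift invariance, and by the mean
    value theorem and uniform continuity it is uniformly close to G, with an error confined to a box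
    of bounded volume. *)
Lemma mint_derive (j : 'I_n) F G : bbs F -> bbs G -> continuous G ->
  (forall x, is_derive x (delta_mx 0 j) F (G x)) -> mint G = 0.
Proof.
move=> [_ [K [_ K0 _ FK]]] Gb cG FG.
have [C [M [C0 M0 GC GM]]] := Gb.
pose L := Num.max K M.
have FL x : L < `|x| -> F x = 0 by rewrite gt_max => /andP[/FK].
have GL x : L < `|x| -> G x = 0 by rewrite gt_max => /andP[_ /GM].
have L0 : 0 <= L by rewrite le_max K0.
have ne : `|delta_mx 0 j : 'rV[R]_n| <= 1.
  by apply: norm_le_coord => // i; rewrite mxE normr_nat lern1 leq_b1.
have key (e : R) : 0 < e -> \forall N \near \oo,
    `|gsum N G| <= e * (2 * (L + 1) + 1) ^+ n.
  move=> e0; have [|d d0 Gd] := @compact_unif_continuous R n G (L + 1) e e0.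
    by move=> x _; exact: cG.
  near=> N; pose h := mesh N : R.
  have h0 : 0 < h := mesh_gt0 N.
  have hd : h < d by apply: (@le_lt_trans _ _ (d / 2));
    [rewrite /h; near: N; apply: near_mesh; rewrite divr_gt0|lra].
  have LN : L + 2 <= N.+1%:R by near: N; exact: near_size.
  (* The subtracted difference quotient sums to 0 over the grid. *)
  have -> : gsum N G = gsum N (fun x => G x + (- h^-1) *
      (F (h *: delta_mx 0 j + x) + (-1) * F x)).
    rewrite gsumD gsumZ gsumD gsumZ gsum_shift ?mulN1r ?subrr ?mulr0 ?addr0//.
    by move=> x Nx; apply: FL; lra.
  rewrite (le_trans (gsum_norm _ _))//.
  apply: (@le_trans _ _ (gsum N (fun x => e * box_ind (L + 1) x))); last first.
    by rewrite gsumZ ler_wpM2l ?(ltW e0)//; apply: gsum_box_le; lra.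
  apply: gsum_le => x.
  have [t /[!in_itv]/= /andP[t0 th] ->] : exists2 t, t \in `]0, h[ &
      F (h *: delta_mx 0 j + x) + -1 * F x = G (t *: delta_mx 0 j + x) * h.
    by rewrite mulN1r; exact: line_MVT.
  rewrite mulNr mulrCA mulVf ?gt_eqF// mulr1.
  have tx : `|x - (t *: delta_mx 0 j + x)| < d.
    rewrite opprD addrCA subrr addr0 normrN normrZ gtr0_norm//.
    by rewrite (le_lt_trans _ (lt_trans th hd))// ler_piMr// ltW.
  have [xL|Lx] := lerP `|x| (L + 1).
    by rewrite box_ind1// mulr1 ltW// Gd.
  rewrite !GL ?subrr ?normr0 ?mulr_ge0 ?box_ind_ge0// ?(ltW e0)//; last lra.
  have h1 : h <= 1 := mesh_le1 N.
  have := lerB_dist x (t *: delta_mx 0 j + x).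
  suff : `|x - (t *: delta_mx 0 j + x)| <= 1 by lra.
  rewrite opprD addrCA subrr addr0 normrN normrZ gtr0_norm//.
  by rewrite mulr_ile1// ltW// (lt_le_trans th).
apply/eqP; rewrite -normr_le0; apply/ler_addgt0Pl => e e0; rewrite addr0.
have B0 : 0 < (2 * (L + 1) + 1) ^+ n by apply: exprn_gt0; lra.
have := key (e / (2 * (L + 1) + 1) ^+ n); rewrite divr_gt0// => /(_ isT).
rewrite divfK ?gt_eqF// => ke.
rewrite ler_norml; apply/andP; split.
  by apply: mint_ge_near => //; apply: filterS ke => N; rewrite ler_norml => /andP[].
by apply: mint_le_near => //; apply: filterS ke => N; rewrite ler_norml => /andP[].
Unshelve. all: by end_near. Qed.

Definition slab_ind (l : 'I_n) (L e : R) (x : 'rV[R]_n) : R :=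
  box_ind L x * ind 0 e (x 0 l).

Lemma slab_ind_ge0 l L e x : 0 <= slab_ind l L e x.
Proof. by rewrite mulr_ge0 ?box_ind_ge0 ?ind_ge0. Qed.

Lemma bbs_slab l L e : 0 <= L -> bbs (slab_ind l L e).
Proof.
move=> L0; apply: bbs_dom (bbs_box L0) => x.
rewrite /slab_ind normrM ler_piMr// ger0_norm ?ind_ge0//.
by rewrite /ind lern1 leq_b1.
Qed.

Lemma mint_slab_le l L e : 0 <= L -> 0 < e ->
  mint (slab_ind l L e) <= (2 * L + 1) ^+ n * (2 * e).
Proof.
move=> L0 e0; apply: mint_le_near; first exact: bbs_slab.
(* Dropping the box constraint in direction [l] leaves a product of one-variable indicators. *)
near=> N; pose g j t := if j == l then ind 0 e t else ind (- L) L t : R.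
apply: (@le_trans _ _ (gsum N (fun x => \prod_j g j (x 0 j)))).
  apply: gsum_le => x; rewrite /slab_ind /box_ind (bigD1 l)//= [leRHS](bigD1 l)//=.
  rewrite /g eqxx mulrAC [X in _ <= _ * X](eq_bigr (fun j => ind (- L) L (x 0 j))); last first.
    by move=> ? /negbTE ->.
  rewrite ler_wpM2r//; first by apply: prodr_ge0 => j _; exact: ind_ge0.
  by rewrite ler_piMl ?ind_ge0// /ind lern1 leq_b1.
rewrite gsum_prod (bigD1 l)//= mulrC.
have S0 j : 0 <= mesh N * \sum_(k < gsize N) g j (node N k).
  rewrite mulr_ge0 ?mesh_ge0// sumr_ge0// => k _.
  by rewrite /g; case: ifP => _; exact: ind_ge0.
apply: ler_pM => //; first by apply: prodr_ge0.
  rewrite -[n in _ ^+ n]card_ord -prodr_const [leRHS](bigD1 l)//=.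
  rewrite -[leLHS]mul1r ler_pM//; first by apply: prodr_ge0.
    by lra.
  apply: ler_prod => j jl; rewrite S0 /= /g (negbTE jl).
  have LL : - L <= L by lra.
  by rewrite (le_trans (sum_ind_le N LL))//; have := @mesh_le1 R N; lra.
rewrite /g eqxx (le_trans (sum_ind_le N (ltW e0)))//.
have : mesh N <= e by near: N; exact: near_mesh.
by lra.
Unshelve. all: by end_near. Qed.

Definition cube_ind (c : 'rV[R]_n) (r : R) (x : 'rV[R]_n) : R :=
  \prod_j ind (c 0 j - r) (c 0 j + r) (x 0 j).

Lemma cube_ind_neq0 c r x : 0 <= r -> cube_ind c r x != 0 -> `|x - c| <= r.
Proof.
move=> r0 /prodf_neq0 x0; apply: norm_le_coord => // j.
have := x0 j isT; rewrite /ind pnatr_eq0 eqb0 negbK !mxE ler_norml.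
by move=> /andP[]; lra.
Qed.

Lemma cube_ind_le1 c r x : cube_ind c r x <= 1.
Proof. by apply: prodr_ile1 => j _; rewrite ind_ge0 /ind lern1 leq_b1. Qed.

Lemma cube_ind_ge0 c r x : 0 <= cube_ind c r x.
Proof. by apply: prodr_ge0 => j _; exact: ind_ge0. Qed.

Lemma bbs_cube c r : 0 <= r -> bbs (cube_ind c r).
Proof.
move=> r0; exists 1, (`|c| + r); split => //; first by rewrite addr_ge0.
  by move=> x; rewrite ger0_norm ?cube_ind_ge0 ?cube_ind_le1.
move=> x cx; apply/eqP; apply: contraTT cx => /(cube_ind_neq0 r0) xc.
by rewrite -leNgt -[x in `|x|](subrK c) addrC (le_trans (ler_normD _ _))// lerD2l.
Qed.

Lemma mint_cube_gt0 c r : 0 < r -> 0 < mint (cube_ind c r).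
Proof.
(* A side of length 2 r loses at most one mesh, hence counts for at least r. *)
move=> r0; apply: (@lt_le_trans _ _ (r ^+ n)); first exact: exprn_gt0.
apply: mint_ge_near; first exact/bbs_cube/ltW.
near=> N; rewrite (gsum_prod N (fun j => ind (c 0 j - r) (c 0 j + r))).
rewrite -[n in _ ^+ n]card_ord -prodr_const; apply: ler_prod => j _.
have mr : mesh N <= r by near: N; exact: near_mesh.
have cN : `|c| + r <= N.+1%:R by near: N; exact: near_size.
have := norm_coord c j; rewrite ler_norml => /andP[? ?].
rewrite ltW//= (le_trans _ (sum_ind_ge _ _))//; lra.
Unshelve. all: by end_near. Qed.

End MeanIntegral.

(** * Green's formula *)

Section Calculus.
Context {R : realType} {n : nat}.
Local Notation V := 'rV[R]_n.
Implicit Types (U : set V).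

Lemma bbs0 : bbs ((fun=> 0) : V -> R).
Proof. by exists 0, 0; split => // x; rewrite normr0. Qed.

Lemma mint0 : mint ((fun=> 0) : V -> R) = 0.
Proof.
apply: etrans (mul0r (mint ((fun=> 0) : V -> R))); rewrite -(mintZ 0 bbs0).
by congr mint; apply/funext => x; rewrite mul0r.
Qed.

Lemma bbs_sum (F : 'I_n -> V -> R) : (forall j, bbs (F j)) ->
  bbs (fun x => \sum_j F j x).
Proof.
move=> Fb; elim: (index_enum _) => [|j s IHb].
  by under eq_fun do rewrite big_nil; exact: bbs0.
by under eq_fun do rewrite big_cons; exact: bbsD.
Qed.

Lemma mint_sum (F : 'I_n -> V -> R) : (forall j, bbs (F j)) ->
  mint (fun x => \sum_j F j x) = \sum_j mint (F j).
Proof.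
move=> Fb; suff [] : bbs (fun x => \sum_j F j x) /\
  mint (fun x => \sum_j F j x) = \sum_j mint (F j) by [].
elim: (index_enum _) => [|j s [IHb IHm]].
  by under eq_fun do rewrite big_nil; rewrite big_nil mint0; split => //; exact: bbs0.
under eq_fun do rewrite big_cons.
by split; [exact: bbsD|rewrite mintD// big_cons IHm].
Qed.

(* f1 j and f2 j are the first and second partial derivatives of f along e_j; mixed
   derivatives play no role. *)
Definition C2 U (f : V -> R) (f1 f2 : 'I_n -> V -> R) := forall x, U x -> [/\ {for x, continuous f},
  forall j, {for x, continuous (f1 j)}, forall j, {for x, continuous (f2 j)},
  forall j, is_derive x (delta_mx 0 j) f (f1 j x) &
  forall j, is_derive x (delta_mx 0 j) (f1 j) (f2 j x)].

Definition lap (f2 : 'I_n -> V -> R) x := \sum_j f2 j x.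

Lemma is_deriveMr (f g : V -> R) x v a b : is_derive x v f a -> is_derive x v g b ->
  is_derive x v (fun x => f x * g x) (a * g x + f x * b).
Proof.
move=> fa gb; apply: (is_derive_eq (is_deriveM fa gb)).
by rewrite /GRing.scale /= addrC mulrC.
Qed.

Lemma is_deriveDr (f g : V -> R) x v a b : is_derive x v f a -> is_derive x v g b ->
  is_derive x v (fun x => f x + g x) (a + b).
Proof. by move=> fa gb; exact: (is_deriveD fa gb). Qed.

Lemma is_deriveNr (f : V -> R) x v a : is_derive x v f a -> is_derive x v (fun x => - f x) (- a).
Proof. by move=> fa; exact: (is_deriveN fa). Qed.

Lemma C2M U f f1 f2 g g1 g2 : C2 U f f1 f2 -> C2 U g g1 g2 ->
  C2 U (fun x => f x * g x) (fun j x => f1 j x * g x + f x * g1 j x)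
    (fun j x => f2 j x * g x + 2 * (f1 j x * g1 j x) + f x * g2 j x).
Proof.
move=> Cf Cg x Ux; have [cf cf1 cf2 df df1] := Cf x Ux.
have [cg cg1 cg2 dg dg1] := Cg x Ux; split => [|j|j|j|j].
- exact: continuousM.
- exact: (continuousD (continuousM (cf1 j) cg) (continuousM cf (cg1 j))).
- have c2 : {for x, continuous (cst 2 : V -> R)} by exact: cst_continuous.
  exact: (continuousD (continuousD (continuousM (cf2 j) cg)
    (continuousM c2 (continuousM (cf1 j) (cg1 j)))) (continuousM cf (cg2 j))).
- exact: is_deriveMr.
- have := is_deriveDr (is_deriveMr (df1 j) (dg j)) (is_deriveMr (df j) (dg1 j)).
  by move=> H; apply: (is_derive_eq H); ring.
Qed.

Lemma C2N U f f1 f2 : C2 U f f1 f2 ->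
  C2 U (fun x => - f x) (fun j x => - f1 j x) (fun j x => - f2 j x).
Proof.
move=> Cf x Ux; have [cf cf1 cf2 df df1] := Cf x Ux; split => [|j|j|j|j].
- exact: continuousN.
- exact: (continuousN (cf1 j)).
- exact: (continuousN (cf2 j)).
- exact: is_deriveNr.
- exact: is_deriveNr.
Qed.

Lemma C2D U f f1 f2 g g1 g2 : C2 U f f1 f2 -> C2 U g g1 g2 ->
  C2 U (fun x => f x + g x) (fun j x => f1 j x + g1 j x) (fun j x => f2 j x + g2 j x).
Proof.
move=> Cf Cg x Ux; have [cf cf1 cf2 df df1] := Cf x Ux.
have [cg cg1 cg2 dg dg1] := Cg x Ux; split => [|j|j|j|j].
- exact: continuousD.
- exact: (continuousD (cf1 j) (cg1 j)).
- exact: (continuousD (cf2 j) (cg2 j)).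
- exact: is_deriveDr.
- exact: is_deriveDr.
Qed.

Lemma is_derive_near0 (f : V -> R) x v d : (\forall y \near x, f y = 0) ->
  is_derive x v f d -> d = 0.
Proof.
move=> f0 [_ <-]; rewrite (@near_eq_derive _ _ _ f (cst 0))//.
exact: derive_cst.
Qed.

Lemma C2_near0 U f f1 f2 x : open U -> C2 U f f1 f2 -> U x ->
  (\forall y \near x, f y = 0) ->
  forall j, f1 j x = 0 /\ f2 j x = 0.
Proof.
move=> oU Cf Ux f0 j.
have f10 : \forall y \near x, f1 j y = 0.
  near=> y; have Uy : U y by near: y; exact: open_nbhs_nbhs.
  have fy0 : \forall z \near y, f z = 0 by apply: (near (near_join f0) y).
  by have [_ _ _ df _] := Cf y Uy; exact: is_derive_near0 (df j).
split; first exact: nbhs_singleton f10.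
by have [_ _ _ _ df1] := Cf x Ux; exact: is_derive_near0 (df1 j).
Unshelve. all: by end_near. Qed.

Lemma continuous_bbs (f : V -> R) (L : R) : continuous f -> (forall x : V, L < `|x| -> f x = 0) ->
  bbs f.
Proof.
move=> cf f0; pose M := Num.max L 0.
have cB := @compact_norm_le R n M.
have B0 : [set x : V | `|x| <= M] !=set0 by exists 0; rewrite /= normr0 le_max lexx orbT.
have [|c cB' cmax] := @EVT_max_rV R n (fun x => `|f x|) _ B0 cB.
  apply: continuous_subspaceT => x.
  by apply: (@continuous_comp _ _ _ f (@Num.norm R R)); [exact: cf|exact: norm_continuous].
exists `|f c|, M; split => //; first by rewrite le_max lexx orbT.
  move=> x; have [xM|Mx] := lerP `|x| M; first by apply: cmax; rewrite inE.
  by rewrite f0 ?normr0// (le_lt_trans _ Mx)// le_max lexx.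
by move=> x; rewrite gt_max => /andP[/f0].
Qed.

Lemma open_coord_gt (l : 'I_n) (a : R) : open [set x : V | a < x 0 l].
Proof.
rewrite (_ : mkset _ = (fun x : V => x 0 l) @^-1` [set y | a < y])//.
by apply: open_comp => [x _|]; [exact: coord_continuous|exact: open_gt].
Qed.

Lemma open_coord_lt (l : 'I_n) (a : R) : open [set x : V | x 0 l < a].
Proof.
rewrite (_ : mkset _ = (fun x : V => x 0 l) @^-1` [set y | y < a])//.
by apply: open_comp => [x _|]; [exact: coord_continuous|exact: open_lt].
Qed.

Lemma open_norm_gt (L : R) : open [set x : V | L < `|x|].
Proof.
rewrite (_ : mkset _ = (fun x : V => `|x|) @^-1` [set y | L < y])//.
by apply: open_comp => [x _|]; [exact: norm_continuous|exact: open_gt].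
Qed.

Lemma near_coord_lt (l : 'I_n) (a : R) (x : V) (P : V -> Prop) :
  (forall y : V, y 0 l < a -> P y) -> x 0 l < a -> \forall y \near x, P y.
Proof.
move=> yP xa; have := open_nbhs_nbhs (conj (@open_coord_lt l a) xa).
by apply: filterS => y; exact: yP.
Qed.

Lemma near_norm_gt (L : R) (x : V) (P : V -> Prop) :
  (forall y : V, L < `|y| -> P y) -> L < `|x| -> \forall y \near x, P y.
Proof.
move=> yP xa; have := open_nbhs_nbhs (conj (@open_norm_gt L) xa).
by apply: filterS => y; exact: yP.
Qed.

(** The integrand v2 f - v f2 is, in each direction, the derivative of v1 f - v f1, whose support is
    bounded and stays at height at least e, so [mint_derive] applies. *)
Lemma green (l : 'I_n) v v1 v2 f f1 f2 (e L : R) :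
  C2 [set x : V | 0 < x 0 l] v v1 v2 -> C2 setT f f1 f2 -> 0 < e ->
  (forall x : V, x 0 l < e -> f x = 0) -> (forall x : V, L < `|x| -> f x = 0) ->
  [/\ bbs (fun x => lap v2 x * f x), bbs (fun x => v x * lap f2 x) &
  mint (fun x => lap v2 x * f x) = mint (fun x => v x * lap f2 x)].
Proof.
move=> Cv Cf e0 fe fL.
have f0 (x : V) : x 0 l < e -> forall j, f1 j x = 0 /\ f2 j x = 0.
  move=> xe; apply: (C2_near0 openT Cf) => //; exact: near_coord_lt xe.
have fL0 (x : V) : L < `|x| -> forall j, f1 j x = 0 /\ f2 j x = 0.
  move=> xe; apply: (C2_near0 openT Cf) => //; exact: near_norm_gt xe.
(* Nothing is known of v on or below the boundary; products with a factor that vanishes for x_l < e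
   are nevertheless continuous everywhere. *)
have glue (w : V -> R) : (forall x : V, 0 < x 0 l -> {for x, continuous w}) ->
    (forall x : V, x 0 l < e -> w x = 0) -> continuous w.
  move=> cw w0 x; have [xl|xl] := ltP 0 (x 0 l); first exact: cw.
  have wx : \forall y \near x, 0 = w y.
    by apply: (@near_coord_lt l e); [move=> y /w0 ->|lra].
  apply: cvg_trans; first exact: near_eq_cvg wx.
  by rewrite (w0 x); [exact: cvg_cst|lra].
pose G j x := v2 j x * f x - v x * f2 j x.
pose F j x := v1 j x * f x - v x * f1 j x.
have Gb1 j : bbs (fun x => v2 j x * f x).
  apply: (@continuous_bbs _ L) => [|x /fL ->]; last by rewrite mulr0.
  apply: glue => [x xl|x /fe ->]; last by rewrite mulr0.
  have [_ _ cv _ _] := Cv x xl; have [cf _ _ _ _] := Cf x I.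
  exact: (continuousM (cv j) cf).
have Gb2 j : bbs (fun x => v x * f2 j x).
  apply: (@continuous_bbs _ L) => [|x /fL0/(_ j)[_ ->]]; last by rewrite mulr0.
  apply: glue => [x xl|x /f0/(_ j)[_ ->]]; last by rewrite mulr0.
  have [cv _ _ _ _] := Cv x xl; have [_ _ cf _ _] := Cf x I.
  exact: (continuousM cv (cf j)).
have Fb j : bbs (F j).
  apply: (@continuous_bbs _ L) => [|x xL]; last first.
    by rewrite /F fL// (fL0 x xL j).1 !mulr0 subr0.
  apply: glue => [x xl|x xl]; last by rewrite /F fe// (f0 x xl j).1 !mulr0 subr0.
  have [cv cv1 _ _ _] := Cv x xl; have [cf cf1 _ _ _] := Cf x I.
  exact: (continuousB (continuousM (cv1 j) cf) (continuousM cv (cf1 j))).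
have Gc j : continuous (G j).
  apply: glue => [x xl|x xl]; last by rewrite /G fe// (f0 x xl j).2 !mulr0 subr0.
  have [cv _ cv2 _ _] := Cv x xl; have [cf _ cf2 _ _] := Cf x I.
  exact: (continuousB (continuousM (cv2 j) cf) (continuousM cv (cf2 j))).
have FG j x : is_derive x (delta_mx 0 j) (F j) (G j x).
  have [xl|xl] := ltP 0 (x 0 l); last first.
    have Fx : \forall y \near x, cst 0 y = F j y.
      apply: (@near_coord_lt l e); last by lra.
      by move=> y ye; rewrite /F fe// (f0 y ye j).1 !mulr0 subr0.
    apply: near_eq_is_derive Fx _.
    rewrite /G fe ?(f0 x _ j).2 ?mulr0 ?subr0; try lra.
    exact: is_derive_cst.
  have [_ _ _ dv dv1] := Cv x xl; have [_ _ _ df df1] := Cf x I.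
  have := is_deriveDr (is_deriveMr (dv1 j) (df j))
    (is_deriveNr (is_deriveMr (dv j) (df1 j))).
  by move=> H; apply: (is_derive_eq H); rewrite /G; ring.
have lapl : (fun x => lap v2 x * f x) = (fun x => \sum_j v2 j x * f x).
  by apply/funext => x; rewrite /lap mulr_suml.
have lapr : (fun x => v x * lap f2 x) = (fun x => \sum_j v x * f2 j x).
  by apply/funext => x; rewrite /lap mulr_sumr.
rewrite lapl lapr; split; [exact: bbs_sum|exact: bbs_sum|].
rewrite !mint_sum//; apply: eq_bigr => j _; apply/eqP; rewrite -subr_eq0.
by rewrite -mintB// -/(G j) (mint_derive _ _ (Gc j) (FG j))//; exact: bbsB.
Qed.

End Calculus.

(** * Truncated powers *)

Section PositivePower.
Context {R : realType}.
Implicit Types (t : R) (b : nat).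

(** At exponent 0 this is the constant 1, even for negative t; hence the successor exponents in the
    vanishing lemmas. *)
Definition ppow b t : R := Num.max t 0 ^+ b.

Lemma ppow_ge0 b t : 0 <= ppow b t.
Proof. by rewrite exprn_ge0// le_max lexx orbT. Qed.

Lemma ppow_neg b t : t <= 0 -> ppow b.+1 t = 0.
Proof. by move=> t0; rewrite /ppow max_r// expr0n. Qed.

Lemma ppow_pos b t : 0 <= t -> ppow b t = t ^+ b.
Proof. by move=> t0; rewrite /ppow max_l. Qed.

Lemma ppow_le1 b t : t <= 1 -> ppow b t <= 1.
Proof. by move=> t1; rewrite exprn_ile1 ?le_max ?lexx ?orbT// ge_max t1 ler01. Qed.

Lemma continuous_ppow b : continuous (ppow b).
Proof.
move=> t; apply: (@continuous_comp _ _ _ (fun t : R => Num.max t 0) (fun t => t ^+ b)).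
  rewrite (_ : (fun t : R => Num.max t 0) = (fun t => (t + `|t|) / 2)).
    apply: cvgM; last exact: cvg_cst.
    by apply: cvgD; [exact: cvg_id|exact: norm_continuous].
  by apply/funext => s; rewrite maxr_absE subr0 addr0.
exact: exprn_continuous.
Qed.

Lemma is_derive_ppow b t :
  is_derive t 1 (ppow b.+2) (b.+2%:R * ppow b.+1 t).
Proof.
have [t0|t0|->] := ltgtP t 0.
- rewrite ppow_neg ?ltW// mulr0.
  apply: near_eq_is_derive (is_derive_cst (0 : R) t 1).
  have := lt_nbhsl t0; apply: filterS => s s0.
  by rewrite ppow_neg// ltW.
- rewrite ppow_pos ?ltW//.
  have H := is_deriveX b.+2 (is_derive_id t 1).
  apply: near_eq_is_derive (is_derive_eq H _).
    have := lt_nbhsr t0; apply: filterS => s s0.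
    by rewrite (ppow_pos _ (ltW s0)) exprfctE.
  by rewrite /GRing.scale /= mulr1.
rewrite ppow_neg// mulr0.
(* At the kink the difference quotient is itself the truncated power of exponent one less, which
   tends to 0. *)
have E : (fun h : R => h^-1 *: (ppow b.+2 (h *: 1 + 0) - ppow b.+2 0)) @ 0^' --> (0 : R).
  rewrite -[X in _ --> X](@ppow_neg b 0)//.
  have c0 : ppow b.+1 @ (0 : R)^' --> ppow b.+1 (0 : R).
    by apply: cvg_within_filter; exact: continuous_ppow.
  apply: cvg_trans c0; apply: near_eq_cvg; near=> h.
  have h0 : h != 0 by near: h; exact: nbhs_dnbhs_neq.
  rewrite [h *: 1]mulr1 addr0 (@ppow_neg _ 0)// subr0.
  have [hp|hn] := ltP 0 h.
    by rewrite !ppow_pos ?ltW// [in RHS]exprS /GRing.scale /= mulKf.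
  by rewrite !ppow_neg// scaler0.
by apply: DeriveDef; [apply/cvg_ex; exists 0|exact: cvg_lim E].
Unshelve. all: by end_near. Qed.

End PositivePower.

(** * Chain rule, constants and coordinates *)

Section Composition.
Context {R : realType} {n : nat}.
Local Notation V := 'rV[R]_n.

Lemma is_derive_comp_line (f : V -> R) (g : R -> R) (x v : V) (a b : R) :
  is_derive x v f a -> is_derive (f x) 1 g b ->
  is_derive x v (fun x => g (f x)) (b * a).
Proof.
move=> fa gb; apply: is_derive_line0.
have fa' : is_derive (0 *: v + x) v f a by rewrite scale0r add0r.
have fl := is_derive_line fa'.
apply: (@is_derive1_comp _ g (fun t => f (t *: v + x))) => //.
by rewrite scale0r add0r.
Qed.

Definition D2 (g g1 g2 : R -> R) := [/\ forall t : R, is_derive t (1 : R) g (g1 t),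
  forall t : R, is_derive t (1 : R) g1 (g2 t) & continuous g2].

Lemma is_derive_continuous (g : R -> R) (t d : R) : is_derive t 1 g d ->
  {for t, continuous g}.
Proof. by move=> [gd _]; exact/differentiable_continuous/derivable1_diffP. Qed.

Lemma C2_comp (U : set V) (f : V -> R) f1 f2 g g1 g2 : C2 U f f1 f2 -> D2 g g1 g2 ->
  C2 U (fun x => g (f x)) (fun j x => g1 (f x) * f1 j x)
    (fun j x => g2 (f x) * f1 j x ^+ 2 + g1 (f x) * f2 j x).
Proof.
move=> Cf [dg dg1 cg2] x Ux; have [cf cf1 cf2 df df1] := Cf x Ux.
have cg' : {for x, continuous (g \o f)}.
  by apply: continuous_comp => //; exact: is_derive_continuous.
have cg1' : {for x, continuous (g1 \o f)}.
  by apply: continuous_comp => //; exact: is_derive_continuous.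
have cg2' : {for x, continuous (g2 \o f)}.
  by apply: continuous_comp => //; exact: cg2.
split => [//|j|j|j|j].
- exact: (continuousM cg1' (cf1 j)).
- exact: (continuousD (continuousM cg2' (continuousM (cf1 j) (cf1 j)))
    (continuousM cg1' (cf2 j))).
- exact: is_derive_comp_line.
- have := is_deriveMr (is_derive_comp_line (df j) (dg1 (f x))) (df1 j).
  by move=> H; apply: (is_derive_eq H); ring.
Qed.

Lemma C2_cst (U : set V) (c : R) : C2 U ((fun=> c) : V -> R) (fun _ _ => 0) (fun _ _ => 0).
Proof.
by move=> x _; split=> *; try exact: cst_continuous; exact: is_derive_cst.
Qed.

Lemma C2_coord (U : set V) (i : 'I_n) :
  C2 U (fun x => x 0 i) (fun j _ => (i == j)%:R) (fun _ _ => 0).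
Proof.
move=> x _; split => [|j|j|j|j]; try exact: cst_continuous.
- exact: coord_continuous.
- apply: is_derive_line0.
  rewrite (_ : (fun _ => _) = (fun t : R => x 0 i + t * (i == j)%:R)); last first.
    by apply/funext => t; rewrite !mxE eqxx /= addrC.
  have := is_deriveD (is_derive_cst (x 0 i) (0 : R) 1)
    (is_deriveM (is_derive_id (0 : R) 1) (is_derive_cst ((i == j)%:R : R) (0 : R) 1)).
  move=> H; apply: (is_derive_eq H).
  by rewrite /GRing.scale /= mul0r !add0r mulr1.
- exact: is_derive_cst.
Qed.

End Composition.

(** * A cut-off function of class C^2 *)

Section Cutoff.
Context {R : realType}.
Implicit Types t : R.

(** A piecewise polynomial step from 0 to 1 over [0, 1]. The inner cube makes it C^2 at t = 0, the
    outer one at t = 1. *)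
Definition cut t : R := 1 - ppow 3 (1 - ppow 3 t).
Definition cut1 t : R := 9 * (ppow 2 (1 - ppow 3 t) * ppow 2 t).
Definition cut2 t : R := 18 * (ppow 2 (1 - ppow 3 t) * ppow 1 t)
  - 54 * (ppow 1 (1 - ppow 3 t) * ppow 2 t ^+ 2).

Lemma D2_cut : D2 cut cut1 cut2.
Proof.
have d3 t : is_derive t 1 (fun t => 1 - ppow 3 t) (- (3 * ppow 2 t)).
  have := is_deriveB (is_derive_cst (1 : R) t 1) (is_derive_ppow 1 t).
  by move=> H; apply: (is_derive_eq H); ring.
split => [t|t|].
- have H1 := @is_derive1_comp _ (ppow 3) _ t _ _ (is_derive_ppow 1 _) (d3 t).
  have := is_deriveB (is_derive_cst (1 : R) t 1) H1.
  by move=> H; apply: (is_derive_eq H); rewrite /cut1; ring.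
- have H1 := @is_derive1_comp _ (ppow 2) _ t _ _ (is_derive_ppow 0 _) (d3 t).
  have := is_deriveZ 9 (is_deriveM H1 (is_derive_ppow 0 t)).
  by move=> H; apply: (is_derive_eq H); rewrite /cut2 /GRing.scale /=; ring.
have c3 b : continuous (fun t : R => ppow b (1 - ppow 3 t)).
  move=> t; apply: (@continuous_comp _ _ _ (fun t => 1 - ppow 3 t) (ppow b)).
    exact: (is_derive_continuous (d3 t)).
  exact: continuous_ppow.
move=> t; apply: (@continuousB _ _ _
    (fun t => 18 * (ppow 2 (1 - ppow 3 t) * ppow 1 t))).
  apply: continuousM; first exact: cst_continuous.
  by apply: continuousM; [exact: c3|exact: continuous_ppow].
apply: continuousM; first exact: cst_continuous.
apply: continuousM; first exact: c3.
by apply: continuousM; exact: continuous_ppow.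
Qed.

Lemma cut_neg t : t <= 0 -> [/\ cut t = 0, cut1 t = 0 & cut2 t = 0].
Proof.
move=> t0; rewrite /cut /cut1 /cut2 !(ppow_neg _ t0) subr0 ppow_pos ?ler01//.
by rewrite expr1n; split; ring.
Qed.

Lemma cut_ge1 t : 1 <= t -> [/\ cut t = 1, cut1 t = 0 & cut2 t = 0].
Proof.
move=> t1; have p0 : 1 - ppow 3 t <= 0.
  by rewrite ppow_pos ?(le_trans ler01)// subr_le0 exprn_ege1.
by rewrite /cut /cut1 /cut2 !(ppow_neg _ p0); split; ring.
Qed.

Lemma cut_bounds t : [/\ 0 <= cut t, cut t <= 1, `|cut1 t| <= 9 & `|cut2 t| <= 54].
Proof.
have [t1|t1] := leP 1 t.
  have [-> -> ->] := cut_ge1 t1; rewrite normr0; split => //; exact: ler0n.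
have p3 := ppow_ge0 3 t; have p2 := ppow_ge0 2 t; have p1 := ppow_ge0 1 t.
have t1' := ltW t1.
have q3 := ppow_le1 3 t1'; have q2 := ppow_le1 2 t1'; have q1 := ppow_le1 1 t1'.
have s1 : 1 - ppow 3 t <= 1 by lra.
have a3 := ppow_ge0 3 (1 - ppow 3 t); have a2 := ppow_ge0 2 (1 - ppow 3 t).
have a1 := ppow_ge0 1 (1 - ppow 3 t).
have b3 := ppow_le1 3 s1; have b2 := ppow_le1 2 s1; have b1 := ppow_le1 1 s1.
have m1 : 0 <= ppow 2 (1 - ppow 3 t) * ppow 2 t <= 1.
  by rewrite mulr_ge0//= mulr_ile1.
have m2 : 0 <= ppow 2 (1 - ppow 3 t) * ppow 1 t <= 1.
  by rewrite mulr_ge0//= mulr_ile1.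
have m3 : 0 <= ppow 1 (1 - ppow 3 t) * ppow 2 t ^+ 2 <= 1.
  by rewrite mulr_ge0 ?exprn_ge0//= mulr_ile1 ?exprn_ge0 ?exprn_ile1.
split; rewrite /cut /cut1 /cut2 ?ler_norml; lra.
Qed.

End Cutoff.

(** * Green's formula up to the boundary *)

Section HalfGreen.
Context {R : realType} {n : nat}.
Local Notation V := 'rV[R]_n.

Definition restr (l : 'I_n) (f : V -> R) (x : V) : R := if 0 < x 0 l then f x else 0.

Lemma C2_lap_bbs (K : V -> R) K1 K2 (L : R) :
  C2 setT K K1 K2 -> (forall x, L < `|x| -> K x = 0) ->
  [/\ forall x, L < `|x| -> forall j, K1 j x = 0 /\ K2 j x = 0,
   exists B, [/\ 0 <= B, forall j x, `|K1 j x| <= B & forall x, `|lap K2 x| <= B]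
   & bbs (lap K2)].
Proof.
move=> CK KL.
have K0 (x : V) : L < `|x| -> forall j, K1 j x = 0 /\ K2 j x = 0.
  by move=> xe; apply: (C2_near0 openT CK) => //; exact: near_norm_gt xe.
have b1 j : bbs (K1 j).
  apply: (@continuous_bbs _ _ _ L) => [x|x /K0/(_ j)[]//].
  by have [_ c _ _ _] := CK x I; exact: c.
have b2 : bbs (lap K2).
  apply: bbs_sum => j; apply: (@continuous_bbs _ _ _ L) => [x|x /K0/(_ j)[]//].
  by have [_ _ c _ _] := CK x I; exact: c.
split => //.
have [B [L' [B0 _ BK _]]] := b2.
pose D j : R := sval (cid (b1 j)).
have D0 j : 0 <= D j by rewrite /D; case: cid => B' [? []].
exists (B + \sum_j D j); split.
- by rewrite addr_ge0// sumr_ge0.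
- move=> j x; apply: (@le_trans _ _ (D j)).
    by rewrite /D; case: cid => B' [? []].
  rewrite (bigD1 j)//= addrCA lerDl addr_ge0// sumr_ge0//.
- by move=> x; rewrite (le_trans (BK x))// lerDl sumr_ge0.
Qed.

Lemma C2_ext (U : set V) f f1 f2 g1 g2 : C2 U f f1 f2 ->
  (forall j x, f1 j x = g1 j x) -> (forall j x, f2 j x = g2 j x) -> C2 U f g1 g2.
Proof.
move=> Cf e1 e2; have -> : g1 = f1 by apply/funext => j; apply/funext => x.
by have -> : g2 = f2 by apply/funext => j; apply/funext => x.
Qed.

(* Green's formula on the half space for v vanishing on the boundary but only continuous
   there. It is applied to K times a cut-off of the slab 0 < x_l < 2 e: the cut-off costs
   derivatives of size 1 / e and 1 / e^2, but K = O(x_l), the slab has volume O(e), and v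
   is small on it. *)
Lemma half_green (l : 'I_n) (v : V -> R) v1 v2 (K : V -> R) K1 K2 (g : V -> R) (L C : R) :
  C2 [set x : V | 0 < x 0 l] v v1 v2 -> C2 setT K K1 K2 -> 0 <= L -> 0 <= C ->
  (forall x, L < `|x| -> K x = 0) ->
  (forall x : V, 0 < x 0 l -> 0 <= K x <= C * x 0 l) ->
  (forall x : V, 0 < x 0 l -> `|x| <= L -> `|v x| <= C) ->
  (forall eta : R, 0 < eta -> exists2 e : R, 0 < e &
    forall x : V, 0 < x 0 l -> x 0 l <= e -> `|x| <= L -> `|v x| <= eta) ->
  bbs g -> (forall x : V, x 0 l <= 0 -> g x = 0) ->
  (forall x : V, L < `|x| -> g x = 0) ->
  (forall x : V, 0 < x 0 l -> g x <= - (lap v2 x * K x)) ->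
  mint g <= mint (restr l (fun x => - (v x * lap K2 x))).
Proof.
move=> Cv CK L0 C0 KL KC vC veta gb gH gL gK.
have [K1L [B [B0 K1B lapB]] lapb] := C2_lap_bbs CK KL.
have lapL x : L < `|x| -> lap K2 x = 0.
  by move=> xL; rewrite /lap big1// => j _; have [] := K1L x xL j.
have [Cg [_ [Cg0 _ gCg _]]] := gb.
have rb : bbs (restr l (fun x => - (v x * lap K2 x))).
  exists (C * B), L; split => //; first by rewrite mulr_ge0.
    move=> x; rewrite /restr; case: ifP => xl; last by rewrite normr0 mulr_ge0.
    have [xL|xL] := leP `|x| L; first by rewrite normrN normrM ler_pM ?vC.
    by rewrite lapL// mulr0 oppr0 normr0 mulr_ge0.
  by move=> x xL; rewrite /restr; case: ifP => // _; rewrite lapL// mulr0 oppr0.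
pose P := (2 * L + 1) ^+ n.
have P0 : 0 < P by apply: exprn_gt0; lra.
have key (eta e : R) : 0 < eta -> 0 < e ->
    (forall x : V, 0 < x 0 l -> x 0 l <= 2 * e -> `|x| <= L -> `|v x| <= eta) ->
    mint g <= mint (restr l (fun x => - (v x * lap K2 x))) +
      (Cg + (C * B + eta * ((108 * C + 18 * B) / e))) * (P * (2 * (2 * e))).
  move=> eta0 e0 ve; have e0' := ltW e0; have eta0' := ltW eta0.
  have ei0 : 0 <= e^-1 by rewrite invr_ge0.
  (* Rescaled height: the cut-off is 0 for x_l <= e and 1 for x_l >= 2 e. *)
  pose w (x : V) := e^-1 * x 0 l + - 1.
  have Cw : C2 setT w (fun j _ => e^-1 * (l == j)%:R) (fun _ _ => 0).
    apply: (C2_ext (C2D (C2M (C2_cst (U:=setT) (e^-1)) (C2_coord l)) (C2_cst (- 1)))) => j x.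
      by rewrite mul0r add0r addr0.
    by rewrite !(mul0r, mulr0) !addr0.
  pose f x := cut (w x) * K x.
  pose f1 j x := cut1 (w x) * (e^-1 * (l == j)%:R) * K x + cut (w x) * K1 j x.
  pose f2 j x := (cut2 (w x) * (e^-1 * (l == j)%:R) ^+ 2 + cut1 (w x) * 0) * K x +
    2 * (cut1 (w x) * (e^-1 * (l == j)%:R) * K1 j x) + cut (w x) * K2 j x.
  have Cx : C2 setT f f1 f2 := C2M (C2_comp Cw D2_cut) CK.
  have w_le0 (x : V) : x 0 l <= e -> w x <= 0.
    by move=> xe; rewrite /w subr_le0 mulrC ler_pdivrMr// mul1r.
  have w_ge1 (x : V) : 2 * e <= x 0 l -> 1 <= w x.
    by move=> xe; rewrite /w lerBrDr mulrC ler_pdivlMr//; lra.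
  have := @green _ _ l v v1 v2 f f1 f2 e L Cv Cx e0.
  case=> [x xe|x xL|]; [|by rewrite /f KL// mulr0|].
    by rewrite /f; have [-> _ _] := cut_neg (w_le0 x (ltW xe)); rewrite mul0r.
  move=> fb1 fb2 fE.
  have lapf x : lap f2 x = cut2 (w x) * e^-1 ^+ 2 * K x +
      2 * (cut1 (w x) * e^-1 * K1 l x) + cut (w x) * lap K2 x.
    rewrite /lap /f2 !big_split /= -!mulr_sumr; congr (_ + _ + _).
      rewrite (bigD1 l)//= big1 => [|j jl]; first by rewrite eqxx /=; ring.
      by rewrite eq_sym (negbTE jl) /=; ring.
    congr (_ * _); rewrite (bigD1 l)//= big1 => [|j jl]; first by rewrite eqxx /=; ring.
    by rewrite eq_sym (negbTE jl) /=; ring.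
  have sb := bbs_slab l (2 * e) L0.
  have slab1 (x : V) : 0 < x 0 l -> x 0 l <= 2 * e -> `|x| <= L -> slab_ind l L (2 * e) x = 1.
    move=> x0 xe xL; rewrite /slab_ind box_ind1// /ind xe andbT.
    by rewrite ltW// mulr1.
  have s0 := slab_ind_ge0 l L (2 * e).
  (* In the slab g is split as cut g + (1 - cut) g: the first part is controlled by the Laplacian of
     v, the second only by the bound of g. *)
  have gle x : g x <= - (lap v2 x * f x) + Cg * slab_ind l L (2 * e) x.
    have [xl|xl] := ltP 0 (x 0 l); last first.
      have we : w x <= 0 by apply: w_le0; lra.
      have [c0 _ _] := cut_neg we.
      by rewrite gH// /f c0 mul0r mulr0 oppr0 add0r mulr_ge0.
    have [xL|xL] := leP `|x| L; last first.
      by rewrite gL// /f KL// !mulr0 oppr0 add0r mulr_ge0.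
    have [c0 c1 _ _] := cut_bounds (w x).
    have gx := gK x xl; have := gCg x; rewrite ler_norml => /andP[_ gC].
    have [xe|xe] := leP (2 * e) (x 0 l).
      have [c1' _ _] := cut_ge1 (w_ge1 _ xe).
      by rewrite /f c1' mul1r (le_trans gx)// lerDl mulr_ge0.
    rewrite (slab1 _ xl (ltW xe) xL) mulr1 /f.
    have -> : - (lap v2 x * (cut (w x) * K x)) = cut (w x) * - (lap v2 x * K x) by ring.
    have := ler_wpM2l c0 gx.
    have : (1 - cut (w x)) * g x <= (1 - cut (w x)) * Cg by rewrite ler_wpM2l// subr_ge0.
    have : 0 <= cut (w x) * Cg by rewrite mulr_ge0.
    by lra.
  pose D := C * B + eta * ((108 * C + 18 * B) / e).
  have D0 : 0 <= D.
    by rewrite addr_ge0 ?mulr_ge0 ?addr_ge0 ?mulr_ge0.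
  (* Derivatives of the cut-off live in the slab. There K <= 2 C e, so the second-order term is at
     most 54 e^-2 (2 C e) = 108 C / e, and the cross term at most 2 (9 / e) B = 18 B / e; both are
     multiplied by |v| <= eta. *)
  have fle x : - (v x * lap f2 x) <= restr l (fun x => - (v x * lap K2 x)) x +
      D * slab_ind l L (2 * e) x.
    rewrite /restr lapf; have [xl|xl] := ltP 0 (x 0 l); last first.
      have we : w x <= 0 by apply: w_le0; lra.
      have [-> -> ->] := cut_neg we.
      by rewrite !mul0r mulr0 !addr0 mulr0 oppr0 add0r mulr_ge0.
    have [xL|xL] := leP `|x| L; last first.
      rewrite KL// (K1L x xL l).1 lapL// !mulr0 !addr0 mulr0 oppr0 add0r.
      by rewrite mulr_ge0.
    have [xe|xe] := leP (2 * e) (x 0 l).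
      have [-> -> ->] := cut_ge1 (w_ge1 _ xe).
      by rewrite !mul0r mulr0 !add0r mul1r lerDl mulr_ge0.
    rewrite (slab1 _ xl (ltW xe) xL) mulr1.
    have [c0 c1 b1 b2] := cut_bounds (w x).
    have /andP[k0 k1] := KC x xl.
    have vx : `|v x| <= eta by apply: ve => //; exact: ltW.
    have T1 : `|v x * (cut2 (w x) * e^-1 ^+ 2 * K x)| <= eta * (108 * C / e).
      have ee0 : 0 <= e^-1 ^+ 2 by rewrite exprn_ge0.
      rewrite normrM ler_pM// [leLHS]normrM [`|K x|]ger0_norm//.
      rewrite [X in X * _]normrM [`|e^-1 ^+ 2|]ger0_norm//.
      apply: (@le_trans _ _ (54 * e^-1 ^+ 2 * (C * (2 * e)))).
        apply: ler_pM => //; first by rewrite mulr_ge0.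
          by rewrite ler_wpM2r.
        by rewrite (le_trans k1)// ler_wpM2l// ltW.
      by rewrite le_eqVlt; apply/orP; left; apply/eqP; field; rewrite gt_eqF.
    have T2 : `|v x * (2 * (cut1 (w x) * e^-1 * K1 l x))| <= eta * (18 * B / e).
      rewrite normrM ler_pM// [leLHS]normrM normr_nat.
      have -> : 18 * B / e = 2 * (9 * e^-1 * B) by ring.
      rewrite ler_wpM2l// [leLHS]normrM [X in X * _]normrM [`|e^-1|]ger0_norm//.
      by apply: ler_pM; rewrite ?mulr_ge0 ?K1B// ler_wpM2r.
    have T3 : `|(1 - cut (w x)) * (v x * lap K2 x)| <= C * B.
      rewrite normrM ger0_norm ?subr_ge0//.
      have d1 : 1 - cut (w x) <= 1 by lra.
      by rewrite (le_trans (ler_piMl _ d1))// normrM ler_pM ?vC ?lapB.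
    have -> : D = C * B + eta * (108 * C / e) + eta * (18 * B / e).
      by rewrite /D; ring.
    move: T1 T2 T3; rewrite !ler_norml => /andP[T1 _] /andP[T2 _] /andP[_ T3].
    set a := cut2 _ * _ in T1 *; set b := cut1 _ * _ in T2 *.
    set c := 108 * C / e in T1 *; set d := 18 * B / e in T2 *.
    clearbody a b c d; move: (v x) (cut (w x)) (lap K2 x) T1 T2 T3 => y z t.
    by clear; lra.
  have fb : bbs (fun x => - (lap v2 x * f x)) by exact: bbsN.
  have fb' : bbs (fun x => - (v x * lap f2 x)) by exact: bbsN.
  have M1 := mint_le gb (bbsD fb (bbsZ Cg sb)) gle.
  have M2 := mint_le fb' (bbsD rb (bbsZ D sb)) fle.
  move: M1 M2; rewrite !mintD//; try exact: bbsZ.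
  rewrite !mintN// fE !mintZ// => M1 M2.
  have e20 : 0 < 2 * e by lra.
  have sl := mint_slab_le l L0 e20.
  have : (Cg + D) * mint (slab_ind l L (2 * e)) <= (Cg + D) * (P * (2 * (2 * e))).
    by rewrite ler_wpM2l// addr_ge0.
  rewrite -/D; lra.
apply/ler_addgt0Pl => tau tau0.
(* The slab volume 4 P e cancels the 1/e, leaving a multiple of eta independent of e. So eta is
   chosen first, then e, each contributing at most tau / 2. *)
pose eta := tau / (8 * P * (108 * C + 18 * B + 1)).
have c0 : 0 < 108 * C + 18 * B + 1 by lra.
have eta0 : 0 < eta by rewrite divr_gt0// mulr_gt0// mulr_gt0.
have [e1 e10 ve1] := veta eta eta0.
pose e := Num.min (e1 / 2) (tau / (8 * P * (Cg + C * B + 1))).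
have d0 : 0 < Cg + C * B + 1 by have := mulr_ge0 C0 B0; lra.
have e0 : 0 < e by rewrite lt_min !divr_gt0// mulr_gt0// mulr_gt0.
have := key eta e eta0 e0.
have ee : 2 * e <= e1.
  have : e <= e1 / 2 by rewrite ge_min lexx.
  by lra.
have ve (x : V) : 0 < x 0 l -> x 0 l <= 2 * e -> `|x| <= L -> `|v x| <= eta.
  by move=> x0 xe; apply: ve1 => //; exact: le_trans ee.
move=> /(_ ve) /le_trans; apply; rewrite addrC lerD2r.
have -> : (Cg + (C * B + eta * ((108 * C + 18 * B) / e))) * (P * (2 * (2 * e))) =
    4 * P * (Cg + C * B) * e + 4 * P * (108 * C + 18 * B) * eta.
  by field; rewrite gt_eqF.
have E1 : 4 * P * (Cg + C * B) * e <= tau / 2.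
  have : e <= tau / (8 * P * (Cg + C * B + 1)) by rewrite ge_min lexx orbT.
  rewrite ler_pdivlMr; last by rewrite mulr_gt0// mulr_gt0.
  have : 0 <= P * e by rewrite mulr_ge0// ltW.
  lra.
have E2 : 4 * P * (108 * C + 18 * B) * eta <= tau / 2.
  have : eta * (8 * P * (108 * C + 18 * B + 1)) = tau.
    by rewrite divfK// gt_eqF// mulr_gt0// mulr_gt0.
  have : 0 <= P * eta by rewrite mulr_ge0// ltW.
  lra.
lra.
Qed.

End HalfGreen.

(** * The kernels K *)

Section TestFunctions.
Context {R : realType} {n : nat}.
Local Notation V := 'rV[R]_n.
Implicit Types (c x : V) (s : R) (k b : nat).

Lemma C2_sum (U : set V) (I : finType) (f : I -> V -> R) (f1 f2 : I -> 'I_n -> V -> R) :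
  (forall i, C2 U (f i) (f1 i) (f2 i)) ->
  C2 U (fun x => \sum_i f i x) (fun j x => \sum_i f1 i j x) (fun j x => \sum_i f2 i j x).
Proof.
move=> Cf; elim: (index_enum I) => [|i r IH].
  have -> : (fun x => \sum_(i <- [::]) f i x) = fun=> 0.
    by apply/funext => x; rewrite big_nil.
  by apply: (C2_ext (C2_cst 0)) => j x; rewrite big_nil.
have -> : (fun x => \sum_(i <- i :: r) f i x) = fun x => f i x + \sum_(i <- r) f i x.
  by apply/funext => x; rewrite big_cons.
by apply: (C2_ext (C2D (Cf i) IH)) => j x; rewrite big_cons.
Qed.

Definition sqd c x : R := \sum_j (x 0 j - c 0 j) ^+ 2.

Definition bump c s k x : R := ppow k (s - sqd c x).

Lemma sqd_ge0 c x : 0 <= sqd c x.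
Proof. by apply: sumr_ge0 => j _; exact: sqr_ge0. Qed.

Lemma C2_sqd c : C2 setT (sqd c) (fun j x => 2 * (x 0 j - c 0 j)) (fun _ _ => 2).
Proof.
have Cy i := C2D (C2_coord (R:=R) (U:=setT) i) (C2_cst (- c 0 i)).
apply: (C2_ext (C2_sum (fun i => C2M (Cy i) (Cy i)))) => j x.
  rewrite (bigD1 j)//= big1 => [|i ij]; first by rewrite eqxx /=; ring.
  by rewrite (negbTE ij) /=; ring.
rewrite (bigD1 j)//= big1 => [|i ij]; first by rewrite eqxx /=; ring.
by rewrite (negbTE ij) /=; ring.
Qed.

Definition bump1 c s k j x : R := k.+3%:R * ppow k.+2 (s - sqd c x) * (- (2 * (x 0 j - c 0 j))).
Definition bump2 c s k j x : R :=
  k.+3%:R * (k.+2%:R * ppow k.+1 (s - sqd c x)) * (2 * (x 0 j - c 0 j)) ^+ 2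
  - 2 * (k.+3%:R * ppow k.+2 (s - sqd c x)).

Lemma D2_ppow k : D2 (ppow k.+3) (fun t : R => k.+3%:R * ppow k.+2 t)
  (fun t => k.+3%:R * (k.+2%:R * ppow k.+1 t)).
Proof.
split => [t|t|t].
- exact: is_derive_ppow.
- exact: (is_deriveZ k.+3%:R (is_derive_ppow k t)).
- have cc (z : R) : {for t, continuous (fun=> z : R)} by exact: cst_continuous.
  have cp : {for t, continuous (ppow k.+1)} by exact: continuous_ppow.
  exact: (continuousM (cc _) (continuousM (cc _) cp)).
Qed.

Lemma C2_bump c s k : C2 setT (bump c s k.+3) (bump1 c s k) (bump2 c s k).
Proof.
have Cr := C2D (C2_cst (U:=setT) s) (C2N (C2_sqd c)).
apply: (C2_ext (C2_comp Cr (D2_ppow k))) => j x.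
  by rewrite /bump1; ring.
by rewrite /bump2; ring.
Qed.

Lemma mulr_ppow k (t : R) : t * ppow k.+1 t = ppow k.+2 t.
Proof.
have [t0|t0] := leP 0 t; first by rewrite !ppow_pos// -exprS.
by rewrite !ppow_neg ?ltW// mulr0.
Qed.

(** The squared gradient of |x - c|^2 is 4 |x - c|^2 = 4 (s - r) with r = s - |x - c|^2, and r
    r_+^(k+1) = r_+^(k+2); the Laplacian thus stays in the same family of kernels. *)
Lemma lap_bump c s k x : lap (bump2 c s k) x =
  4 * k.+3%:R * (k.+2%:R * s * bump c s k.+1 x
                 - (k.+2%:R + n%:R / 2) * bump c s k.+2 x).
Proof.
rewrite /lap /bump2 big_split /= sumr_const card_ord -mulr_sumr.
under eq_bigr do rewrite exprMn.
rewrite -mulr_sumr -/(sqd c x) /bump -mulr_natr.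
set r := s - sqd c x; have -> : sqd c x = s - r by rewrite /r; ring.
by rewrite -(mulr_ppow k r); field.
Qed.

Variable l : 'I_n.

Definition refl c : V := \row_j (if j == l then - c 0 j else c 0 j).

Definition Kf c s k x : R := bump c s k x - bump (refl c) s k x.

Definition Kf2 c s k j x : R := bump2 c s k j x - bump2 (refl c) s k j x.

Lemma C2_Kf c s k : C2 setT (Kf c s k.+3)
  (fun j x => bump1 c s k j x - bump1 (refl c) s k j x) (Kf2 c s k).
Proof. exact: (C2D (C2_bump c s k) (C2N (C2_bump (refl c) s k))). Qed.

Lemma lap_Kf c s k x : lap (Kf2 c s k) x =
  4 * k.+3%:R * (k.+2%:R * s * Kf c s k.+1 x - (k.+2%:R + n%:R / 2) * Kf c s k.+2 x).
Proof. by rewrite /lap sumrB -!/(lap _ _) !lap_bump /Kf; ring. Qed.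

Lemma sqd_refl c x : sqd (refl c) x = sqd c x + 4 * (x 0 l * c 0 l).
Proof.
rewrite /sqd (bigD1 l)//= [in RHS](bigD1 l)//= !mxE eqxx.
rewrite (eq_bigr (fun j => (x 0 j - c 0 j) ^+ 2)); first by ring.
by move=> j /negbTE jl; rewrite mxE jl.
Qed.

Lemma norm_refl c : `|refl c| = `|c|.
Proof.
apply/eqP; rewrite eq_le; apply/andP; split; apply: norm_le_coord => // j.
  by have := norm_coord c j; rewrite mxE; case: ifP => // _; rewrite normrN.
by have := norm_coord (refl c) j; rewrite mxE; case: ifP => // _; rewrite normrN.
Qed.

Lemma norm_sqd c x : `|x - c| ^+ 2 <= sqd c x.
Proof.
rewrite -[leRHS]sqr_sqrtr ?sqd_ge0// lerXn2r ?nnegrE ?sqrtr_ge0//.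
apply: norm_le_coord => [|j]; first exact: sqrtr_ge0.
rewrite -sqrtr_sqr ler_wsqrtr// !mxE /sqd (bigD1 j)//= lerDl.
by apply: sumr_ge0 => i _; exact: sqr_ge0.
Qed.

Lemma bump_support c s k x : `|c| + Num.sqrt s < `|x| -> bump c s k.+1 x = 0.
Proof.
move=> xL; rewrite /bump ppow_neg// subr_le0.
have [s0|s0] := leP s 0; first exact: le_trans s0 (sqd_ge0 c x).
rewrite (le_trans _ (norm_sqd c x))// -[s in s <= _]sqr_sqrtr ?(ltW s0)//.
rewrite lerXn2r ?nnegrE ?sqrtr_ge0//.
have := ler_normD (x - c) c; rewrite subrK; lra.
Qed.

Lemma Kf_support c s k x : `|c| + Num.sqrt s < `|x| -> Kf c s k.+1 x = 0.
Proof. by move=> xL; rewrite /Kf !bump_support ?norm_refl// subrr. Qed.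

(** The difference is a - e times a sum of k+1 products a^i e^(k-i), of which a^k is the largest.
    The kernels, differences of powers, can so be compared as if they were a^k (a - e). *)
Lemma subrX_le (a e : R) k : 0 <= e -> e <= a ->
  a ^+ k * (a - e) <= a ^+ k.+1 - e ^+ k.+1 <= k.+1%:R * (a ^+ k * (a - e)).
Proof.
move=> e0 ea; have a0 := le_trans e0 ea.
elim: k => [|k /andP[IH1 IH2]]; first by rewrite !expr0 !expr1 !mul1r lexx.
have -> : a ^+ k.+2 - e ^+ k.+2 = a ^+ k.+1 * (a - e) + e * (a ^+ k.+1 - e ^+ k.+1).
  by rewrite !exprS; ring.
have d0 : 0 <= a ^+ k.+1 - e ^+ k.+1 by rewrite subr_ge0 lerXn2r.
have d1 : e * (a ^+ k.+1 - e ^+ k.+1) <= a * (a ^+ k.+1 - e ^+ k.+1).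
  by rewrite ler_wpM2r.
have d2 : a * (a ^+ k.+1 - e ^+ k.+1) <= a * (k.+1%:R * (a ^+ k * (a - e))).
  by rewrite ler_wpM2l.
have d3 : 0 <= e * (a ^+ k.+1 - e ^+ k.+1) by rewrite mulr_ge0.
have E : a * (k.+1%:R * (a ^+ k * (a - e))) = k.+1%:R * (a ^+ k.+1 * (a - e)).
  by rewrite exprS; ring.
by apply/andP; split; rewrite -?(natr1 k.+1) ?mulrDl ?mul1r; lra.
Qed.

Definition rho c s x : R := Num.max (s - sqd c x) 0.

Lemma KfE c s k x : Kf c s k x = rho c s x ^+ k - rho (refl c) s x ^+ k.
Proof. by []. Qed.

Lemma rho_ge0 c s x : 0 <= rho c s x.
Proof. by rewrite le_max lexx orbT. Qed.

Lemma rho_le c s x : 0 <= s -> rho c s x <= s.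
Proof. by move=> s0; rewrite ge_max s0 lerBlDr lerDl sqd_ge0. Qed.

Lemma rho_refl c s x : 0 < c 0 l -> 0 < x 0 l ->
  rho (refl c) s x <= rho c s x /\
  rho c s x - rho (refl c) s x <= 4 * (x 0 l * c 0 l).
Proof.
move=> c0 x0; have xc : 0 < x 0 l * c 0 l by rewrite mulr_gt0.
rewrite /rho sqd_refl; move: (sqd c x) (_ * _) xc => d y y0.
by case: (lerP (s - d) 0); case: (lerP (s - (d + 4 * y)) 0); split; lra.
Qed.

(** The mirror image is farther from x by 4 x_l c_l in squared distance: this gives both the sign
    and the linear decay at the boundary that [half_green] requires. *)
Lemma Kf_bounds c s k x : 0 < c 0 l -> 0 < x 0 l -> 0 <= s ->
  0 <= Kf c s k.+1 x <= k.+1%:R * s ^+ k * (4 * c 0 l) * x 0 l.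
Proof.
move=> c0 x0 s0; have [r1 r2] := rho_refl s c0 x0.
have /andP[b1 b2] := subrX_le k (rho_ge0 (refl c) s x) r1.
rewrite KfE; apply/andP; split.
  by rewrite (le_trans _ b1)// mulr_ge0 ?exprn_ge0 ?rho_ge0 ?subr_ge0.
rewrite (le_trans b2)// -!mulrA ler_wpM2l//.
rewrite ler_pM ?exprn_ge0 ?rho_ge0 ?subr_ge0//.
  by rewrite lerXn2r ?nnegrE ?rho_ge0// rho_le.
by rewrite mulrCA mulrC -mulrA in r2 *; rewrite (le_trans r2)// mulrCA.
Qed.

End TestFunctions.

(** * Two facts on real functions *)

Section SignChain.
Context {R : realType}.

(** Take q (p - 1) >= 1, k = m q and B >= 1, 1/e. If u t^(m q) <= B^q, then D = B^q suffices.
    Otherwise u > (B / t^m)^q with B / t^m >= 1, so u^(p-1) t^m >= B >= 1/e. That k is independent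
    of e matters: e will be chosen in terms of constants depending on k. *)
Lemma powR_young (p : R) (m : nat) : 1 < p -> exists k : nat, forall e : R, 0 < e ->
  exists2 D : R, 0 <= D & forall (u t : R) (d : nat), 0 <= u -> 0 <= t <= 1 ->
    u * t ^+ (k + d).+1 <= e * (u `^ p * t ^+ (k + d + m).+1) + D.
Proof.
move=> p1; have p0 : 0 < p - 1 by rewrite subr_gt0.
have [q qp] : exists q : nat, 1 <= q%:R * (p - 1).
  exists (Num.bound (p - 1)^-1); rewrite -ler_pdivrMr// mul1r.
  by apply/ltW/archi_boundP; rewrite invr_ge0 ltW.
exists (m * q)%N => e e0.
pose B := Num.max 1 e^-1; have B1 : 1 <= B by rewrite le_max lexx.
have B0 : 0 <= B := le_trans ler01 B1.
exists (B ^+ q) => [|u t d u0 /andP[t0 t1]]; first exact: exprn_ge0.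
have P0 : 0 <= e * (u `^ p * t ^+ (m * q + d + m).+1).
  by rewrite mulr_ge0 ?mulr_ge0 ?powR_ge0 ?exprn_ge0// ltW.
have Bq0 : 0 <= B ^+ q by exact: exprn_ge0.
have [utB|But] := leP (u * t ^+ (m * q)) (B ^+ q).
  rewrite (@le_trans _ _ (B ^+ q))//; last by rewrite lerDr.
  rewrite -addnS exprD mulrA (le_trans _ utB)// ler_piMr ?mulr_ge0 ?exprn_ge0//.
  exact: exprn_ile1.
rewrite (@le_trans _ _ (e * (u `^ p * t ^+ (m * q + d + m).+1)))//; last first.
  by rewrite lerDl.
have u_gt0 : 0 < u.
  rewrite lt_neqAle u0 andbT; apply: contraTneq But => <-.
  by rewrite mul0r -leNgt.
have t_gt0 : 0 < t ^+ m.
  rewrite lt_neqAle exprn_ge0// andbT; apply: contraTneq But => tm.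
  have q0 : (0 < q)%N by rewrite lt0n; apply: contraTneq qp => ->; rewrite mul0r ler10.
  by rewrite exprM -tm expr0n gtn_eqF// mulr0 -leNgt.
have tm1 : t ^+ m <= 1 by exact: exprn_ile1.
have H : B <= u `^ (p - 1) * t ^+ m.
  rewrite -ler_pdivrMr//; set z := B / t ^+ m.
  have z1 : 1 <= z by rewrite ler_pdivlMr// mul1r (le_trans tm1).
  have zu : z ^+ q <= u.
    rewrite /z exprMn exprVn -exprM ler_pdivrMr; first exact: ltW.
    by rewrite exprM exprn_gt0.
  apply: (@le_trans _ _ ((z ^+ q) `^ (p - 1))); last first.
    by rewrite ge0_ler_powR ?nnegrE ?exprn_ge0 ?(le_trans ler01 z1)// ltW.
  rewrite -powR_mulrn ?(le_trans ler01 z1)// -powRrM.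
  by rewrite -[leLHS]powRr1 ?(le_trans ler01 z1)// ler_powR.
have -> : u `^ p = u * u `^ (p - 1).
  rewrite -{2}(@powRr1 _ u) ?ltW// -powRD; first by congr (_ `^ _); ring.
  by rewrite (gt_eqF u_gt0) implybT.
have E : t ^+ (m * q + d + m).+1 = t ^+ (m * q + d).+1 * t ^+ m.
  by rewrite -addSn exprD.
rewrite E.
have -> : e * (u * u `^ (p - 1) * (t ^+ (m * q + d).+1 * t ^+ m)) =
  (u * t ^+ (m * q + d).+1) * (e * (u `^ (p - 1) * t ^+ m)) by ring.
rewrite ler_peMr ?mulr_ge0 ?exprn_ge0//.
rewrite (@le_trans _ _ (e * B))//; last by rewrite ler_wpM2l// ltW.
by rewrite -ler_pdivrMl// mulr1 le_max lexx orbT.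
Qed.

Lemma sign_chain (m : nat) (b d : nat -> R -> R) (C : nat -> R) (M : R) :
  (forall i, (i < m)%N -> forall s : R, 0 < s -> is_derive s (1 : R) (b i) (d i s)) ->
  (forall i, 0 < C i) ->
  (forall i, (i.+1 < m)%N -> forall s : R, 0 < s -> d i s = - (C i * b i.+1 s)) ->
  (forall i, (i.+1 = m)%N -> forall s : R, 0 < s -> d i s <= 0) ->
  (forall s : R, 1 <= s -> `|b 0%N s| <= M) ->
  forall i, (0 < i < m)%N -> forall s : R, 0 < s -> 0 <= b i s.
Proof.
move=> bd C0 dE dm bM.
have mvt i (s t : R) : (i < m)%N -> 0 < s -> s <= t ->
    exists2 z, s <= z & b i t - b i s = d i z * (t - s).
  move=> im s0 st; have st0 z : s <= z -> 0 < z by exact: lt_le_trans.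
  have [z||z zst E] := @MVT_segment _ (b i) (d i) s t st.
  - by rewrite in_itv /= => /andP[/ltW/st0 z0 _]; exact: bd.
  - apply: derivable_within_continuous => z; rewrite in_itv /= => /andP[/st0 z0 _].
    by have [] := bd i im z z0.
  - by exists z => //; move: zst; rewrite in_itv /= => /andP[].
(* A lasting gap eta makes -sg b_j grow at least linearly with slope C_j eta; S' is when it must
   have passed T. *)
have diverge j : (j.+1 < m)%N -> forall sg eta S : R, 0 < eta -> 1 <= S ->
    (forall s : R, S <= s -> eta <= sg * b j.+1 s) ->
    forall T : R, exists2 S' : R, S <= S' & forall s : R, S' <= s -> T <= (- sg) * b j s.
  move=> jm sg eta S eta0 S1 H T.
  have c0 : 0 < C j * eta by rewrite mulr_gt0.
  exists (S + `|T + sg * b j S| / (C j * eta)); first by rewrite lerDl divr_ge0// ltW.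
  move=> s Ss; have SS : S <= s.
    by rewrite (le_trans _ Ss)// lerDl divr_ge0// ltW.
  have S0 : 0 < S by lra.
  have [z Sz E] := mvt j S s (ltnW jm) S0 SS.
  have z0 : 0 < z by lra.
  have Hz := H z Sz; rewrite dE// in E.
  have Cz : C j * eta <= C j * (sg * b j.+1 z) by rewrite ler_wpM2l// ltW.
  have D1 : `|T + sg * b j S| <= (s - S) * (C j * eta).
    by rewrite -ler_pdivrMr// lerBrDl.
  have D2 : (s - S) * (C j * eta) <= (s - S) * (C j * (sg * b j.+1 z)).
    by rewrite ler_wpM2l// subr_ge0.
  have := ler_norm (T + sg * b j S).
  have -> : - sg * b j s = (s - S) * (C j * (sg * b j.+1 z)) - sg * b j S.
    have -> : b j s = b j S - C j * b j.+1 z * (s - S) by lra.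
    by ring.
  by lra.
(* Here sg is 1 or -1: the sign flips at each step down the chain, and at b_0 the divergence
   contradicts the bound M. *)
have absurd j : (j.+1 < m)%N -> forall sg eta S : R, sg ^+ 2 = 1 -> 0 < eta -> 1 <= S ->
    (forall s : R, S <= s -> eta <= sg * b j.+1 s) -> False.
  elim: j => [|j IH] jm sg eta S sg1 eta0 S1 H.
    have [S' SS' H'] := diverge 0%N jm sg eta S eta0 S1 H (M + 1).
    have := H' S' (lexx _); have := bM S' (le_trans S1 SS').
    have : `|- sg| = 1.
      by apply/eqP; rewrite normrN -sqrp_eq1// real_normK ?num_real// sg1.
    move=> sgn bS' sgb; have := ler_norm (- sg * b 0%N S').
    by rewrite normrM sgn mul1r; lra.
  have [S' SS' H'] := diverge j.+1 jm sg eta S eta0 S1 H 1.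
  apply: (IH (ltnW jm) (- sg) 1 S') => //; first by rewrite sqrrN.
  exact: le_trans SS'.
(* Descending induction from i = m - 1: nonnegativity of b_(i+1) makes b_i nonincreasing, so a
   negative value persists. *)
suff down k i : (0 < i < m)%N -> (m <= i + k)%N -> forall s : R, 0 < s -> 0 <= b i s.
  by move=> i im; apply: (down m i im); rewrite leq_addl.
elim: k i => [|k IH] i /andP[i0 im] mik; first by rewrite addn0 leqNgt im in mik.
move=> s0 s00; rewrite leNgt; apply/negP => bneg.
have dle z : 0 < z -> d i z <= 0.
  move=> z0; have [im1|] := ltnP i.+1 m.
    rewrite dE// oppr_le0 mulr_ge0 ?(ltW (C0 i))//.
    by apply: IH => //; rewrite addSnnS.
  by move=> mi; apply: dm => //; apply/eqP; rewrite eqn_leq im mi.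
case: i i0 im mik bneg dle => // i _ im mik bneg dle.
pose S := Num.max 1 s0.
apply: (absurd i im (- 1) (- b i.+1 s0) S); rewrite ?sqrrN ?expr1n ?oppr_gt0//.
  by rewrite le_max lexx.
move=> s; rewrite ge_max => /andP[_ ss]; rewrite mulN1r lerN2.
have [z sz E] := mvt i.+1 s0 s im s00 ss.
rewrite -subr_le0 E mulr_le0_ge0// ?subr_ge0// dle//.
exact: lt_le_trans sz.
Qed.

End SignChain.

(** * Taylor remainders *)

Section Taylor.
Context {R : realType}.
Implicit Types (t h s : R).

Lemma MVT_sym (g dg : R -> R) a b : (forall s, is_derive s (1 : R) g (dg s)) ->
  exists2 c, `|c - a| <= `|b - a| & g b - g a = dg c * (b - a).
Proof.
move=> gd; have cg (A : set R) : {within A, continuous g}.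
  by apply: continuous_subspaceT => s; exact: (is_derive_continuous (gd s)).
have [ab|/ltW ba] := leP a b.
  have [c] := MVT_segment ab (fun x _ => gd x) (cg _).
  rewrite in_itv /= => /andP[ac cb] E; exists c => //.
  by rewrite !ger0_norm ?subr_ge0// lerB.
have [c] := MVT_segment ba (fun x _ => gd x) (cg _).
rewrite in_itv /= => /andP[ac cb] E; exists c; last by lra.
by rewrite !ler0_norm ?subr_le0// lerN2 lerB.
Qed.

Lemma D2_taylor (g g1 g2 : R -> R) t h B : D2 g g1 g2 ->
  (forall s, `|s - t| <= `|h| -> `|g2 s| <= B) ->
  `|g (t + h) - g t - h * g1 t| <= B * h ^+ 2.
Proof.
move=> [dg dg1 _] gB.
have th : t + h - t = h by ring.
have [c ct ->] := MVT_sym t (t + h) dg; rewrite th in ct *.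
have [d dc E] := MVT_sym t c dg1.
have -> : g1 c * h - h * g1 t = g2 d * (c - t) * h by rewrite -E; ring.
rewrite !normrM -[h ^+ 2]real_normK ?num_real// expr2 mulrA ler_wpM2r//.
by rewrite ler_pM// gB// (le_trans dc).
Qed.

Lemma ppow_le k t M : 0 <= M -> t <= M -> ppow k t <= M ^+ k.
Proof.
by move=> M0 tM; rewrite lerXn2r ?nnegrE// ?ge_max ?tM// le_max lexx orbT.
Qed.

Lemma ppow_taylor k t h M : 0 <= M -> t + `|h| <= M ->
  `|ppow k.+3 (t + h) - ppow k.+3 t - h * (k.+3%:R * ppow k.+2 t)|
    <= k.+3%:R * (k.+2%:R * M ^+ k.+1) * h ^+ 2.
Proof.
move=> M0 tM; apply: (D2_taylor (D2_ppow k)) => s st.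
rewrite ger0_norm ?mulr_ge0 ?ppow_ge0// !ler_wpM2l// ppow_le//.
have := ler_norm (s - t); lra.
Qed.

(** A quadratic remainder, unlike a bare derivative, can be integrated in x: this is how means are
    differentiated in s. *)
Lemma taylor_is_derive (g : R -> R) t d D r : 0 <= D -> 0 < r ->
  (forall h, `|h| <= r -> `|g (t + h) - g t - h * d| <= D * h ^+ 2) ->
  is_derive t (1 : R) g d.
Proof.
move=> D0 r0 gD.
have E : (fun h : R => h^-1 *: (g (h *: 1 + t) - g t)) @ 0^' --> d.
  apply/cvgrPdist_le => e e0; near=> h.
  have h0 : h != 0 by near: h; exact: nbhs_dnbhs_neq.
  have h1 : `|h| <= r by near: h; apply: dnbhs0_le.
  have he : `|h| <= e / (D + 1).
    by near: h; apply: dnbhs0_le; rewrite divr_gt0// ltr_wpDl.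
  rewrite [h *: 1]mulr1 [h + t]addrC.
  have -> : d - h^-1 *: (g (t + h) - g t) = - (h^-1 * (g (t + h) - g t - h * d)).
    by rewrite /GRing.scale /=; field.
  rewrite normrN normrM normfV ler_pdivrMl ?normr_gt0//.
  rewrite (le_trans (gD h h1))// -real_normK ?num_real// expr2 mulrCA.
  rewrite ler_wpM2l// ?normr_ge0//.
  move: he; rewrite ler_pdivlMr ?ltr_wpDl//.
  by rewrite mulrDr mulr1 => he; rewrite mulrC; have := normr_ge0 h; lra.
by apply: DeriveDef; [apply/cvg_ex; exists d|exact: cvg_lim E].
Unshelve. all: by end_near. Qed.

End Taylor.

(** * Means of the iterated Laplacians against the kernels *)

Section IteratedMeans.
Context {R : realType} {n m : nat} (n2m : n = m.*2) (l : 'I_n).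
Local Notation V := 'rV[R]_n.
Context (w : nat -> V -> R) (w1 w2 : nat -> 'I_n -> V -> R).
Hypothesis w_C2 : forall i, (i < m)%N -> C2 [set x : V | 0 < x 0 l] (w i) (w1 i) (w2 i).
Hypothesis w_lap : forall i (x : V), (i < m)%N -> 0 < x 0 l -> w i.+1 x = - lap (w2 i) x.
Hypothesis w_bounded : forall i (L : R), (i < m)%N ->
  exists2 C : R, 0 <= C & forall x : V, 0 < x 0 l -> `|x| <= L -> `|w i x| <= C.
Hypothesis w_boundary : forall i (L eta : R), (i < m)%N -> 0 < eta -> exists2 e : R, 0 < e &
  forall x : V, 0 < x 0 l -> x 0 l <= e -> `|x| <= L -> `|w i x| <= eta.

Context (c : V) (c_gt0 : 0 < c 0 l).
Implicit Types (s : R) (i k : nat).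

Local Notation K := (Kf l c).
Definition radius s : R := `|c| + Num.sqrt s.

Lemma radius_ge0 s : 0 <= radius s.
Proof. by rewrite addr_ge0// sqrtr_ge0. Qed.

Lemma restrM_bbs (f : V -> R) s k : 0 <= s ->
  (exists2 C : R, 0 <= C & forall x : V, 0 < x 0 l -> `|x| <= radius s -> `|f x| <= C) ->
  bbs (restr l (fun x => f x * K s k.+1 x)).
Proof.
move=> s0 [C C0 fC]; exists (C * s ^+ k.+1), (radius s); split => //.
- by rewrite mulr_ge0 ?exprn_ge0.
- exact: radius_ge0.
- move=> x; rewrite /restr; case: ifP => xl; last by rewrite normr0 mulr_ge0 ?exprn_ge0.
  have [xL|xL] := leP `|x| (radius s); last first.
    by rewrite Kf_support// mulr0 normr0 mulr_ge0 ?exprn_ge0.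
  have /andP[k0 _] := Kf_bounds k c_gt0 xl s0.
  rewrite normrM ler_pM ?fC// ger0_norm// KfE.
  rewrite lerBlDr (le_trans (lerXn2r _ _ _ (rho_le c x s0))) ?nnegrE ?rho_ge0//.
  by rewrite lerDl exprn_ge0// rho_ge0.
- by move=> x xL; rewrite /restr; case: ifP => // _; rewrite Kf_support// mulr0.
Qed.

Lemma mean_green_le (v : V -> R) v1 v2 k s (g : V -> R) :
  C2 [set x : V | 0 < x 0 l] v v1 v2 ->
  (forall L : R, exists2 C : R, 0 <= C & forall x : V, 0 < x 0 l -> `|x| <= L -> `|v x| <= C) ->
  (forall L eta : R, 0 < eta -> exists2 e : R, 0 < e &
    forall x : V, 0 < x 0 l -> x 0 l <= e -> `|x| <= L -> `|v x| <= eta) ->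
  0 <= s -> bbs g -> (forall x : V, x 0 l <= 0 -> g x = 0) ->
  (forall x : V, radius s < `|x| -> g x = 0) ->
  (forall x : V, 0 < x 0 l -> g x <= - lap v2 x * K s k.+3 x) ->
  mint g <= 4 * k.+3%:R * ((k.+2 + m)%:R * mint (restr l (fun x => v x * K s k.+2 x))
    - k.+2%:R * s * mint (restr l (fun x => v x * K s k.+1 x))).
Proof.
move=> Cv bv vb s0 gb g0 gL gK.
have [C C0 vC] := bv (radius s).
(* The slope of the kernel at the boundary; C + B then serves as the common constant of [half_green]
   for v and for K. *)
pose B := k.+3%:R * s ^+ k.+2 * (4 * c 0 l).
have B0 : 0 <= B.
  by apply: mulr_ge0; apply: mulr_ge0 => //; [exact: exprn_ge0|exact: ltW].
apply: (@le_trans _ _ (mint (restr l (fun x => - (v x * lap (Kf2 l c s k) x))))).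
  apply: (half_green Cv (C2_Kf l c s k) (radius_ge0 s) (addr_ge0 C0 B0)) => //.
  - by move=> x; exact: Kf_support.
  - move=> x xl; have /andP[-> h] := Kf_bounds k.+2 c_gt0 xl s0.
    rewrite (le_trans h)// ler_wpM2r//; first exact: ltW.
    by rewrite lerDr.
  - by move=> x xl xL; rewrite (le_trans (vC x xl xL))// lerDl.
  - by move=> eta eta0; exact: vb.
  - by move=> x xl; rewrite -mulNr gK.
have -> : restr l (fun x => - (v x * lap (Kf2 l c s k) x)) = (fun x =>
    4 * k.+3%:R * (k.+2 + m)%:R * restr l (fun x => v x * K s k.+2 x) x -
    4 * k.+3%:R * (k.+2%:R * s) * restr l (fun x => v x * K s k.+1 x) x).
  apply/funext => x; rewrite /restr; case: ifP => _; last by rewrite !mulr0 subrr.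
  have nE : n%:R / 2 = m%:R :> R by rewrite n2m -mul2n natrM; field.
  by rewrite lap_Kf nE natrD; ring.
have vKb q : bbs (restr l (fun x => v x * K s q.+1 x)) by exact: restrM_bbs.
rewrite mintB; try by apply: bbsZ; exact: vKb.
rewrite !mintZ; try exact: vKb.
by lra.
Qed.

Definition kmean i k s : R := mint (restr l (fun x => w i x * K s k x)).

Lemma wK_bbs i k s : (i < m)%N -> 0 <= s -> bbs (restr l (fun x => w i x * K s k.+1 x)).
Proof. by move=> im s0; apply: restrM_bbs => //; exact: w_bounded. Qed.

Lemma kmean_green_le i k s (g : V -> R) : (i < m)%N -> 0 <= s ->
  bbs g -> (forall x : V, x 0 l <= 0 -> g x = 0) ->
  (forall x : V, radius s < `|x| -> g x = 0) ->
  (forall x : V, 0 < x 0 l -> g x <= w i.+1 x * K s k.+3 x) ->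
  mint g <= 4 * k.+3%:R * ((k.+2 + m)%:R * kmean i k.+2 s - k.+2%:R * s * kmean i k.+1 s).
Proof.
move=> im s0 gb g0 gL gK; apply: (mean_green_le (w_C2 im)) => //.
- by move=> L; exact: w_bounded.
- by move=> L eta; exact: w_boundary.
- by move=> x xl; rewrite -w_lap// gK.
Qed.

(** Below the top order w_(i+1) K is bounded, so the one-sided Green formula holds with equality in
    the minorant, for w_i and for -w_i. *)
Lemma kmeanS i k s : (i.+1 < m)%N -> 0 <= s ->
  kmean i.+1 k.+3 s =
  4 * k.+3%:R * ((k.+2 + m)%:R * kmean i k.+2 s - k.+2%:R * s * kmean i k.+1 s).
Proof.
move=> im s0; have im' := ltnW im.
have out (x : V) : x 0 l <= 0 -> restr l (fun x => w i.+1 x * K s k.+3 x) x = 0.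
  by move=> x0; rewrite /restr ltNge x0.
have far (x : V) : radius s < `|x| -> restr l (fun x => w i.+1 x * K s k.+3 x) x = 0.
  by move=> xL; rewrite /restr Kf_support// mulr0; case: ifP.
have wb := wK_bbs k.+2 im s0.
apply/eqP; rewrite eq_le; apply/andP; split.
  by apply: kmean_green_le => // x xl; rewrite /restr xl.
have H : mint (fun x => - restr l (fun x => w i.+1 x * K s k.+3 x) x) <=
    4 * k.+3%:R * ((k.+2 + m)%:R * mint (restr l (fun x => - w i x * K s k.+2 x))
    - k.+2%:R * s * mint (restr l (fun x => - w i x * K s k.+1 x))).
  apply: (mean_green_le (C2N (w_C2 im'))) => //.
  - move=> L; have [C C0 wC] := w_bounded L im'.
    by exists C => // x xl xL; rewrite normrN wC.
  - move=> L eta eta0; have [e e0 we] := w_boundary L im' eta0.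
    by exists e => // x xl xe xL; rewrite normrN we.
  - exact: bbsN.
  - by move=> x /out ->; rewrite oppr0.
  - by move=> x /far ->; rewrite oppr0.
  - move=> x xl; rewrite /restr xl w_lap// /lap sumrN opprK -/(lap _ _).
    by rewrite mulNr opprK.
have E q : mint (restr l (fun x => - w i x * K s q.+1 x)) = - kmean i q.+1 s.
  rewrite -mintN; last exact: wK_bbs.
  by congr mint; apply/funext => x; rewrite /restr; case: ifP; rewrite ?mulNr ?oppr0.
by move: H; rewrite !E mintN// -/(kmean i.+1 k.+3 s); lra.
Qed.

(** Differentiation under the integral: the Taylor remainders of the two bumps are at most A h^2
    each, uniformly on one box, since |h| <= min(1, s) keeps s + h in [0, s + 1]. *)
Lemma is_derive_kmean i k s : (i < m)%N -> 0 < s ->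
  is_derive s 1 (kmean i k.+3) (k.+3%:R * kmean i k.+2 s).
Proof.
move=> im s0.
have [C C0 wC] := w_bounded (radius (s + 1)) im.
pose A := k.+3%:R * (k.+2%:R * (s + 1) ^+ k.+1).
have A0 : 0 <= A.
  by apply: mulr_ge0 => //; apply: mulr_ge0 => //; apply: exprn_ge0; lra.
pose B := (2 * radius (s + 1) + 1) ^+ n.
have r10 := radius_ge0 (s + 1).
have B0 : 0 <= B by apply: exprn_ge0; lra.
apply: (@taylor_is_derive _ _ _ _ (C * (2 * A) * B) (Num.min 1 s)).
- by apply: mulr_ge0 => //; apply: mulr_ge0 => //; apply: mulr_ge0.
- by rewrite lt_min ltr01 s0.
move=> h; rewrite le_min => /andP[h1 hs].
have D0 : 0 <= C * (2 * A) by apply: mulr_ge0 => //; apply: mulr_ge0.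
have D1 : 0 <= C * (2 * A) * h ^+ 2 by apply: mulr_ge0 => //; exact: sqr_ge0.
have sh0 : 0 <= s + h by move: hs; rewrite ler_norml => /andP[]; lra.
have s0' := ltW s0.
have b1 := wK_bbs k.+2 im sh0; have b2 := wK_bbs k.+2 im s0'.
have b3 := wK_bbs k.+1 im s0'.
rewrite /kmean -[k.+3%:R * _]mintZ//.
have b3' := bbsZ k.+3%:R b3.
rewrite -(mintZ h b3') -mintB// -mintB//; last 2 first.
- exact: bbsB.
- exact: bbsZ.
apply: (@le_trans _ _ (mint (fun x => C * (2 * A) * h ^+ 2 * box_ind (radius (s + 1)) x))).
  apply: mint_norm_le.
  - by apply: bbsB; [exact: bbsB|exact: bbsZ].
  - exact/bbsZ/bbs_box.
  move=> x; rewrite /restr; case: ifP => xl; last first.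
    by rewrite !mulr0 !subr0 normr0 mulr_ge0// box_ind_ge0.
  have rad z : z <= s + 1 -> radius z <= radius (s + 1).
    by move=> zs; rewrite lerD2l ler_wsqrtr.
  have [xL|xL] := leP `|x| (radius (s + 1)); last first.
    have rh : radius (s + h) < `|x|.
      by apply: le_lt_trans xL; apply: rad; have := ler_norm h; lra.
    have rs : radius s < `|x| by apply: le_lt_trans xL; apply: rad; lra.
    by rewrite !Kf_support// !mulr0 !subr0 normr0 mulr_ge0// box_ind_ge0.
  rewrite box_ind1// mulr1.
  have T d : 0 <= sqd d x ->
      `|bump d (s + h) k.+3 x - bump d s k.+3 x - h * (k.+3%:R * bump d s k.+2 x)| <= A * h ^+ 2.
    move=> d0; rewrite /bump.
    have -> : s + h - sqd d x = s - sqd d x + h by ring.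
    by apply: ppow_taylor; lra.
  have T1 := T c (sqd_ge0 _ _); have T2 := T (refl l c) (sqd_ge0 _ _).
  have -> : w i x * K (s + h) k.+3 x - w i x * K s k.+3 x - h * (k.+3%:R * (w i x * K s k.+2 x)) =
    w i x * ((bump c (s + h) k.+3 x - bump c s k.+3 x - h * (k.+3%:R * bump c s k.+2 x)) -
    (bump (refl l c) (s + h) k.+3 x - bump (refl l c) s k.+3 x
     - h * (k.+3%:R * bump (refl l c) s k.+2 x))).
    by rewrite /Kf; ring.
  rewrite normrM -[leRHS]mulrA; apply: ler_pM => //; first exact: wC.
  rewrite (le_trans (ler_normB _ _))//.
  have -> : 2 * A * h ^+ 2 = A * h ^+ 2 + A * h ^+ 2 by ring.
  exact: lerD T1 T2.
rewrite mintZ; last exact: bbs_box.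
have -> : C * (2 * A) * B * h ^+ 2 = C * (2 * A) * h ^+ 2 * B by ring.
by apply: ler_wpM2l => //; exact: mint_box_le.
Qed.

Hypothesis w_ge0 : forall x : V, 0 < x 0 l -> 0 <= w 0 x.
Hypothesis wm_ge0 : forall x : V, 0 < x 0 l -> 0 <= w m x.

Lemma mint_restr_ge0 (f : V -> R) : bbs (restr l f) ->
  (forall x : V, 0 < x 0 l -> 0 <= f x) -> 0 <= mint (restr l f).
Proof.
by move=> fb f0; apply: mint_ge0 => // x; rewrite /restr; case: ifP => // /f0.
Qed.

Lemma kmean0_ge0 k s : (0 < m)%N -> 0 <= s -> 0 <= kmean 0 k.+1 s.
Proof.
move=> m0 s0; apply: mint_restr_ge0; first exact: wK_bbs.
move=> x xl; rewrite mulr_ge0 ?w_ge0//.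
by have /andP[] := Kf_bounds k c_gt0 xl s0.
Qed.

Lemma Kf_ge0 k s (x : V) : 0 < x 0 l -> 0 <= s -> 0 <= K s k.+1 x.
Proof. by move=> xl s0; have /andP[] := Kf_bounds k c_gt0 xl s0. Qed.

(** Surplus powers of rho are traded for powers of s, as rho <= s. *)
Lemma Kf_addn k d s (x : V) : 0 < x 0 l -> 0 <= s ->
  K s (k + d).+1 x <= (k + d).+1%:R * s ^+ d * K s k.+1 x.
Proof.
move=> xl s0; have [r1 _] := rho_refl s c_gt0 xl.
have r0 := rho_ge0 (refl l c) s x; have r0' := rho_ge0 c s x.
have /andP[_ B1] := subrX_le (k + d) r0 r1.
have /andP[B2 _] := subrX_le k r0 r1.
rewrite !KfE (le_trans B1)// -mulrA ler_wpM2l//.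
rewrite (@le_trans _ _ (s ^+ d * (rho c s x ^+ k * (rho c s x - rho (refl l c) s x))))//.
  rewrite exprD mulrA [s ^+ d * _]mulrC ler_wpM2r ?subr_ge0//.
  by rewrite ler_wpM2l ?exprn_ge0// lerXn2r ?nnegrE// rho_le.
by rewrite ler_wpM2l ?exprn_ge0.
Qed.

(** Each use of [kmeanS] lowers the exponent by 2 with a factor s, or by 1 without it. The free
    surplus [d] lets the induction cover both terms, and both scale as s^(i + d). *)
Lemma kmean_bound k i d : (i < m)%N -> exists2 C, 0 <= C & forall s, 0 <= s ->
  `|kmean i (k.+1 + i.*2 + d) s| <= C * s ^+ (i + d) * kmean 0 k.+1 s.
Proof.
elim: i d => [|i IH] d im.
  exists (k + d).+1%:R => // s s0; rewrite doubleE addn0 add0n addSn.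
  rewrite ger0_norm ?kmean0_ge0// -mintZ; last exact: wK_bbs.
  apply: mint_le; [exact: wK_bbs|by apply: bbsZ; exact: wK_bbs|].
  move=> x; rewrite /restr; case: ifP => xl; last by rewrite mulr0.
  by rewrite mulrCA ler_wpM2l ?w_ge0// Kf_addn.
have im' := ltnW im.
have [C1 C10 H1] := IH d.+1 im'; have [C2 C20 H2] := IH d im'.
pose q := (k + i.*2 + d)%N.
have E0 : (k.+1 + i.+1.*2 + d = q.+3)%N by rewrite /q doubleS; lia.
have E1 : (k.+1 + i.*2 + d.+1 = q.+2)%N by rewrite /q; lia.
have E2 : (k.+1 + i.*2 + d = q.+1)%N by rewrite /q; lia.
exists (4 * q.+3%:R * ((q.+2 + m)%:R * C1 + q.+2%:R * C2)).
  by rewrite mulr_ge0// addr_ge0// mulr_ge0.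
move=> s s0; have := H1 s s0; have := H2 s s0; rewrite E0 E1 E2 => h2 h1.
rewrite kmeanS// normrM ger0_norm//.
have -> : 4 * q.+3%:R * ((q.+2 + m)%:R * C1 + q.+2%:R * C2) * s ^+ (i.+1 + d) * kmean 0 k.+1 s =
  4 * q.+3%:R * ((q.+2 + m)%:R * (C1 * s ^+ (i + d.+1) * kmean 0 k.+1 s) +
    q.+2%:R * s * (C2 * s ^+ (i + d) * kmean 0 k.+1 s)).
  by rewrite addnS addSn exprS; ring.
rewrite ler_wpM2l// (le_trans (ler_normB _ _))// lerD//.
  by rewrite normrM ger0_norm// ler_wpM2l.
by rewrite normrM ger0_norm ?mulr_ge0// ler_wpM2l ?mulr_ge0.
Qed.

(** * The a priori bound drawn from the equation *)

Context (p A : R) (p_gt1 : 1 < p) (A_gt0 : 0 < A) (m_gt1 : (1 < m)%N).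
(** The weighted nonlinearity as seen at scale s. The region |x| < 1 is left out since |x|^a may be
    arbitrarily small there when a > 0. *)
Hypothesis weight : forall s (x : V), 1 <= s -> 0 < x 0 l -> 1 <= `|x| -> `|x| <= radius s ->
  A / s ^+ m * w 0 x `^ p <= w m x.

Let m_gt0 : (0 < m)%N. Proof. exact: ltnW. Qed.

Lemma Kf_le k s (x : V) : 0 < x 0 l -> 0 <= s -> K s k x <= s ^+ k.
Proof.
move=> xl s0; rewrite KfE lerBlDr.
rewrite (le_trans (lerXn2r _ _ _ (rho_le c x s0))) ?nnegrE ?rho_ge0//.
by rewrite lerDl exprn_ge0// rho_ge0.
Qed.

(* The estimate obtained by testing the equation against K s (k.+3 + 2 m) and absorbing. *)
Lemma capacity : exists k C, forall s, 1 <= s -> kmean 0 k.+3 s <= C * s ^+ (k.+3 + m).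
Proof.
have [k young] := powR_young m.*2 p_gt1.
pose b := k.+3; pose E (x : V) : R := (1 <= `|x|)%R%:R.
(* Green's formula at i = m - 1 leaves two means of w_(m-1); brought down to u they scale as s^m and
   as s times s^(m-1). *)
have [B B0 HB] : exists2 C, 0 <= C & forall s, 0 <= s ->
    4 * (b + m.*2)%:R * ((k.+2 + m.*2 + m)%:R * kmean m.-1 (b + m.-1.*2 + 1) s
      - (k.+2 + m.*2)%:R * s * kmean m.-1 (b + m.-1.*2 + 0) s) <= C * s ^+ m * kmean 0 b s.
  have mm : (m.-1 < m)%N by rewrite prednK.
  have [C1 C10 H1] := kmean_bound k.+2 1 mm.
  have [C2 C20 H2] := kmean_bound k.+2 0 mm.
  exists (4 * (b + m.*2)%:R * ((k.+2 + m.*2 + m)%:R * C1 + (k.+2 + m.*2)%:R * C2)).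
    by rewrite mulr_ge0// addr_ge0// mulr_ge0.
  move=> s s0; have h1 := H1 s s0; have h2 := H2 s s0.
  have e1 : (m.-1 + 1 = m)%N by rewrite addn1 prednK.
  rewrite e1 in h1; rewrite [(m.-1 + 0)%N]addn0 in h2.
  move: h1 h2 => /ler_normlW h1; rewrite ler_norml => /andP[h2 _].
  have -> : 4 * (b + m.*2)%:R * ((k.+2 + m.*2 + m)%:R * C1 + (k.+2 + m.*2)%:R * C2) *
      s ^+ m * kmean 0 b s =
    4 * (b + m.*2)%:R * ((k.+2 + m.*2 + m)%:R * (C1 * s ^+ m * kmean 0 b s) +
      (k.+2 + m.*2)%:R * s * (C2 * s ^+ m.-1 * kmean 0 b s)).
    have -> : s ^+ m = s * s ^+ m.-1 by rewrite -exprS prednK.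
    by ring.
  rewrite ler_wpM2l// lerD// ?ler_wpM2l// -mulrN ler_wpM2l ?mulr_ge0//.
  by rewrite lerNl.
have b0 : 0 < b%:R :> R by rewrite ltr0n.
(* With this e the u^p term, once bounded through the equation, costs at most half the mean of u and
   is absorbed. *)
pose e := A / (2 * b%:R * (B + 1)).
have B1 : 0 < B + 1 by rewrite ltr_wpDl.
have e0 : 0 < e by rewrite divr_gt0// mulr_gt0// mulr_gt0.
have [D D0 HD] := young e e0.
have [C C0 wC] := w_bounded 1 m_gt0.
pose P := (2 * `|c| + 3) ^+ n.
exists k, (2 * ((b%:R * D + C) * P)) => s s1.
have s0 : 0 <= s by rewrite (le_trans ler01).
have s_gt0 : 0 < s by rewrite (lt_le_trans ltr01).
have sm0 : 0 < s ^+ m by rewrite exprn_gt0.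
have sb0 : 0 <= s ^+ b by rewrite exprn_ge0.
pose f (x : V) := A / s ^+ m * w 0 x `^ p * E x.
have E01 x : 0 <= E x <= 1 by rewrite /E ler0n lern1 leq_b1.
have [M M0 wM] := w_bounded (radius s) m_gt0.
have fb q : bbs (restr l (fun x => f x * K s q.+1 x)).
  apply: restrM_bbs => //; exists (A / s ^+ m * M `^ p).
    by rewrite mulr_ge0 ?powR_ge0// divr_ge0// ltW.
  move=> x xl xL; have /andP[E0 E1] := E01 x.
  have f0 : 0 <= A / s ^+ m * w 0 x `^ p.
    by rewrite mulr_ge0 ?powR_ge0// divr_ge0// ltW.
  rewrite [`|f x|]ger0_norm; last exact: mulr_ge0.
  apply: le_trans (ler_piMr f0 E1) _; rewrite ler_wpM2l ?divr_ge0 ?(ltW A_gt0) ?(ltW sm0)//.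
  rewrite ge0_ler_powR ?nnegrE ?w_ge0 ?(le_trans ler01 (ltW p_gt1))//.
  exact: le_trans (ler_norm _) (wM x xl xL).
have G1 : mint (restr l (fun x => f x * K s (b + m.*2) x)) <= B * s ^+ m * kmean 0 b s.
  apply: le_trans (HB s s0).
  have -> : (b + m.-1.*2 + 1 = (k + m.*2).+2)%N by rewrite /b; clear -m_gt0; lia.
  have -> : (b + m.-1.*2 + 0 = (k + m.*2).+1)%N by rewrite /b; clear -m_gt0; lia.
  have := @kmean_green_le m.-1 (k + m.*2) s; rewrite prednK// !addSn; apply => //.
  - by move=> x x0; rewrite /restr ltNge x0.
  - by move=> x xL; rewrite /restr Kf_support// mulr0; case: ifP.
  - move=> x xl; rewrite /restr xl.
    have [xL|xL] := leP `|x| (radius s); last by rewrite Kf_support// !mulr0.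
    rewrite ler_wpM2r ?Kf_ge0// /f /E; case: (leP 1 `|x|) => [x1|_].
      by rewrite mulr1 weight.
    by rewrite mulr0 wm_ge0.
(* The radius is O(sqrt s) for s >= 1, and n = 2m turns the volume into O(s^m). *)
have vol : (2 * radius s + 1) ^+ n <= P * s ^+ m.
  have sq1 : 1 <= Num.sqrt s by rewrite -sqrtr1 ler_wsqrtr.
  have cs : `|c| <= `|c| * Num.sqrt s by rewrite ler_peMr.
  have r0 := radius_ge0 s.
  rewrite (@le_trans _ _ (((2 * `|c| + 3) * Num.sqrt s) ^+ n))//.
    have nc := normr_ge0 c; have ncs := mulr_ge0 nc (le_trans ler01 sq1).
    by rewrite lerXn2r ?nnegrE /radius//; move: cs nc ncs sq1;
      move: (`|c|) (Num.sqrt s) => y z; lra.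
  rewrite exprMn [in X in _ * X]n2m -mul2n exprM sqr_sqrtr//.
have G2 : kmean 0 b s <= b%:R * e / A / s ^+ m * mint (restr l (fun x => f x * K s (b + m.*2) x))
    + (b%:R * D + C) * s ^+ b * (P * s ^+ m).
  have cs0 : 0 <= (b%:R * D + C) * s ^+ b.
    by apply: mulr_ge0 => //; apply: addr_ge0 => //; apply: mulr_ge0.
  have bb := bbs_box (n := n) (radius_ge0 s).
  have fbb : bbs (restr l (fun x => f x * K s (b + m.*2) x)) by rewrite addSn.
  apply: (@le_trans _ _ (mint (fun x =>
     b%:R * e / A / s ^+ m * restr l (fun x => f x * K s (b + m.*2) x) x +
     (b%:R * D + C) * s ^+ b * box_ind (radius s) x))); last first.
    rewrite mintD ?mintZ//; try exact: bbsZ.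
    rewrite lerD2l ler_wpM2l// (le_trans _ vol)// mint_box_le//.
    exact: radius_ge0.
  apply: mint_le; first exact: wK_bbs.
    by apply: bbsD; exact: bbsZ.
  move=> x; rewrite /restr; case: ifP => xl; last first.
    by rewrite mulr0 add0r mulr_ge0// box_ind_ge0.
  have K0 := Kf_ge0 k.+2 xl s0; have K1 := Kf_ge0 (k.+2 + m.*2) xl s0.
  have u0 := w_ge0 xl; have [E0 E1] := andP (E01 x).
  have q0 : 0 <= b%:R * e / A / s ^+ m.
    by rewrite !divr_ge0 ?(ltW A_gt0) ?(ltW sm0)// mulr_ge0// ltW.
  have fK0 : 0 <= f x * K s (b + m.*2) x.
    rewrite mulr_ge0// mulr_ge0// mulr_ge0 ?powR_ge0// divr_ge0//; exact: ltW.
  have [xL|xL] := leP `|x| (radius s); last first.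
    rewrite [K s b x](@Kf_support _ _ _ _ _ k.+2)// mulr0.
    by apply: addr_ge0; apply: mulr_ge0 => //; exact: box_ind_ge0.
  (* In the unit ball the minorant f gives nothing, but u <= C and K <= s^b there. *)
  rewrite box_ind1// mulr1; case: (leP 1 `|x|) => [x1|/ltW x1]; last first.
    rewrite (@le_trans _ _ (C * s ^+ b))//.
      by rewrite ler_pM// ?Kf_le//; exact: le_trans (ler_norm _) (wC x xl x1).
    have P1 := mulr_ge0 q0 fK0.
    have P2 : 0 <= b%:R * D * s ^+ b by apply: mulr_ge0 => //; exact: mulr_ge0.
    by move: P1 P2; lra.
  have [r1 _] := rho_refl s c_gt0 xl.
  have r0 := rho_ge0 (refl l c) s x; have r0' := rho_ge0 c s x.
  have rs := rho_le c x s0.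
  (* With r and r' the values of rho at c and at its mirror image, K_b <= b r^(k+2) (r - r') while
     K_(b+2m) >= r^(k+2+2m) (r - r'). Young's inequality is used for t = r / s, with the factor r -
     r' <= s kept outside. *)
  have /andP[_ L1] := subrX_le k.+2 r0 r1.
  have /andP[L2 _] := subrX_le (k.+2 + m.*2) r0 r1.
  move: L1 L2 r0' rs r1 r0; rewrite -KfE -KfE.
  move: (rho c s x) (rho (refl l c) s x) => r r' L1 L2 r0' rs r1 r0.
  have t01 : 0 <= r / s <= 1 by rewrite divr_ge0//= ler_pdivrMr// mul1r.
  have := HD (w 0 x) (r / s) 1%N u0 t01; rewrite !addn1 => Y.
  have d0 : 0 <= b%:R * s ^+ k.+2 * (r - r').
    by rewrite mulr_ge0 ?subr_ge0// mulr_ge0// exprn_ge0.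
  have {}Y := ler_wpM2l d0 Y.
  have sk0 : s ^+ k.+2 != 0 by rewrite expf_neq0// gt_eqF.
  have sn0 : s != 0 by rewrite gt_eqF.
  apply: le_trans (ler_wpM2l u0 L1) _.
  have -> : w 0 x * (b%:R * (r ^+ k.+2 * (r - r'))) =
      b%:R * s ^+ k.+2 * (r - r') * (w 0 x * (r / s) ^+ k.+2).
    by rewrite expr_div_n; field.
  apply: le_trans Y _; rewrite mulrDr; apply: lerD; last first.
    rewrite (@le_trans _ _ (b%:R * D * s ^+ b))//; last first.
      by rewrite ler_wpM2r// lerDl.
    have -> : b%:R * s ^+ k.+2 * (r - r') * D = b%:R * D * s ^+ k.+2 * (r - r') by ring.
    have -> : b%:R * D * s ^+ b = b%:R * D * s ^+ k.+2 * s by rewrite /b [s ^+ k.+3]exprSr; ring.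
    apply: ler_wpM2l; first by apply: mulr_ge0; [exact: mulr_ge0|exact: exprn_ge0].
    by lra.
  have -> : b%:R * s ^+ k.+2 * (r - r') * (e * (w 0 x `^ p * (r / s) ^+ (k.+1 + m.*2).+1)) =
      b%:R * e / A / s ^+ m * (A / s ^+ m * w 0 x `^ p) * (r ^+ (k.+2 + m.*2) * (r - r')).
    rewrite -[(k.+1 + m.*2).+1]addSn expr_div_n [s ^+ (_ + _)]exprD.
    rewrite -[m.*2]addnn [s ^+ (m + m)]exprD.
    by field; rewrite ?sk0 ?gt_eqF.
  rewrite /f /E x1 mulr1 -[leLHS]mulrA; apply: ler_wpM2l => //; apply: ler_wpM2l => //.
  by rewrite mulr_ge0 ?powR_ge0// divr_ge0//; exact: ltW.
have E0 : b%:R * e / A / s ^+ m * (B * s ^+ m * kmean 0 b s) <= kmean 0 b s / 2.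
  have N0 := kmean0_ge0 k.+2 m_gt0 s0.
  have -> : b%:R * e / A / s ^+ m * (B * s ^+ m * kmean 0 b s) =
      B / (B + 1) * (kmean 0 b s / 2).
    by rewrite /e; field; rewrite !gt_eqF.
  by rewrite ler_piMl ?divr_ge0// ler_pdivrMr// mul1r lerDl.
have q0 : 0 <= b%:R * e / A / s ^+ m.
  by rewrite !divr_ge0 ?(ltW A_gt0) ?(ltW sm0)// mulr_ge0// ltW.
have := ler_wpM2l q0 G1; rewrite exprD.
by move: G2 E0; lra.
Qed.

(** The normalizing power is chosen so that the numerator is the right side of [kmeanS] one exponent
    higher, up to the factor 4 (k+4). *)
Lemma is_derive_kmean_ratio i k s : (i < m)%N -> 0 < s ->
  is_derive s 1 (fun s => kmean i k.+3 s / s ^+ (m + k.+3))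
    (- (((k.+3 + m)%:R * kmean i k.+3 s - k.+3%:R * s * kmean i k.+2 s) / s ^+ (m + k.+4))).
Proof.
move=> im s0; have s_neq0 : s != 0 by rewrite gt_eqF.
have sX := is_deriveX (m + k.+3) (is_derive_id s (1 : R)).
have sXn : (fun s : R => s) ^+ (m + k.+3) = (fun s => s ^+ (m + k.+3)).
  by rewrite exprfctE.
rewrite sXn in sX.
have sn0 : s ^+ (m + k.+3) != 0 by rewrite expf_neq0.
have H := is_deriveM (@is_derive_kmean i k s im s0)
  (@is_deriveV _ (fun s => s ^+ (m + k.+3)) s _ 1 sn0 sX).
apply: (is_derive_eq H); rewrite /GRing.scale /= mulr1 !addnS !exprS natrD.
have sm0 : s ^+ (m + k) != 0 by rewrite expf_neq0.
rewrite -!natr1 !natrD; field.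
by rewrite s_neq0 sm0.
Qed.

Lemma kmean_ge0 : exists k, forall i s, (0 < i < m)%N -> 0 < s -> 0 <= kmean i (k.+3 + i) s.
Proof.
have [k [C HC]] := capacity; exists k.
pose b i s := kmean i (k + i).+3 s / s ^+ (m + (k + i).+3).
pose d i s := - (((k + i).+3 + m)%:R * kmean i (k + i).+3 s
  - (k + i).+3%:R * s * kmean i (k + i).+2 s) / s ^+ (m + (k + i).+4).
pose D i : R := (4 * (k + i).+4%:R)^-1.
have D0 i : 0 < D i by rewrite invr_gt0 mulr_gt0.
have bd i : (i < m)%N -> forall s : R, 0 < s -> is_derive s (1 : R) (b i) (d i s).
  move=> im s s0; have := is_derive_kmean_ratio (k + i) im s0.
  by rewrite /d mulNr.
have dS i : (i.+1 < m)%N -> forall s : R, 0 < s -> d i s = - (D i * b i.+1 s).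
  move=> im s s0; rewrite /d /b /D (addnS k i) kmeanS ?(ltW s0)// mulNr.
  have E (x y z : R) : z != 0 -> z^-1 * (z * x / y) = x / y.
    by move=> z0; rewrite -mulrA mulKf.
  by rewrite E// mulf_neq0 ?pnatr_eq0.
have dm i : i.+1 = m -> forall s : R, 0 < s -> d i s <= 0.
  move=> im s s0; have s0' := ltW s0.
  rewrite /d mulNr oppr_le0 divr_ge0 ?exprn_ge0//.
  have im' : (i < m)%N by rewrite -im.
  (* At top order 0 itself is a bounded minorant of w_m K. *)
  have := @kmean_green_le i (k + i).+1 s (fun=> 0) im' s0' (bbs0).
  rewrite mint0 => /(_ _ _ _) H.
  have {}H : 0 <= 4 * (k + i).+4%:R * (((k + i).+3 + m)%:R * kmean i (k + i).+3 s -
       (k + i).+3%:R * s * kmean i (k + i).+2 s).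
    by apply: H => // x xl; rewrite im mulr_ge0 ?wm_ge0// Kf_ge0.
  by move: H; rewrite pmulr_rge0// mulr_gt0.
have b0 s : 1 <= s -> `|b 0%N s| <= C.
  move=> s1; have s0 : 0 < s by rewrite (lt_le_trans ltr01).
  rewrite /b addn0 ger0_norm.
    by rewrite ler_pdivrMr ?exprn_gt0// addnC HC.
  by rewrite divr_ge0 ?exprn_ge0 ?kmean0_ge0// ltW.
move=> i s im s0; have := sign_chain bd D0 dS dm b0 im s0.
by rewrite /b pmulr_lge0// invr_gt0 exprn_gt0.
Qed.

Lemma iterated_ge0 i : (0 < i < m)%N -> 0 <= w i c.
Proof.
move=> im; have /andP[_ im'] := im; have [k Hk] := kmean_ge0.
rewrite leNgt; apply/negP => wc.
have [cw _ _ _ _] := w_C2 im' c_gt0.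
have /cvgrPdist_lt /(_ (- w i c / 2)) := cw.
rewrite divr_gt0 ?oppr_gt0// => /(_ isT) /nbhs_ballP[r /= r0 rw].
(* The bump of scale s lives within distance r1 / 2 of c, where w_i < w_i(c) / 2; the mirror bump,
   at distance at least c_l >= r1, vanishes on the half space. *)
pose r1 := Num.min r (c 0 l); have r10 : 0 < r1 by rewrite lt_min r0.
pose s := (r1 / 2) ^+ 2.
have s0 : 0 < s by rewrite exprn_gt0// divr_gt0.
have := Hk i s im s0; rewrite leNgt => /negP; apply.
(* A cube that makes the mean strictly negative: e <= 1 gives n e^2 <= n e <= s / 2, hence rho >= s
   / 2 on it, and e <= c_l / 2 keeps it in the half space. *)
pose e : R := Num.min (Num.min 1 (c 0 l / 2)) (s / (2 * n.+1%:R)).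
have e0 : 0 < e by rewrite !lt_min ltr01 !divr_gt0 ?mulr_gt0 ?ltr0n.
pose q := (- w i c / 2) * (s / 2) ^+ (k.+3 + i).
have q0 : 0 < q by rewrite mulr_gt0 ?exprn_gt0 ?divr_gt0// oppr_gt0.
have cb := bbs_cube c (ltW e0).
apply: (@le_lt_trans _ _ (mint (fun x => - q * cube_ind c e x))); last first.
  by rewrite mintZ// mulNr oppr_lt0 mulr_gt0// mint_cube_gt0.
apply: mint_le; [by apply: wK_bbs => //; exact: ltW|exact: bbsZ|move=> x].
have cube0 := cube_ind_ge0 c e x; have cube1 := cube_ind_le1 c e x.
have ec : cube_ind c e x != 0 -> 0 < x 0 l.
  move=> /(cube_ind_neq0 (ltW e0)) xe.
  have := le_trans (norm_coord (x - c) l) xe; rewrite !mxE ler_norml => /andP[xe' _].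
  have : e <= c 0 l / 2 by rewrite !ge_min lexx orbT.
  by move: xe' c_gt0; lra.
rewrite /restr; case: ifP => xl; last first.
  have [->|/ec] := eqVneq (cube_ind c e x) 0; first by rewrite mulr0.
  by rewrite xl.
have rf0 : rho (refl l c) s x = 0.
  rewrite /rho max_r// subr_le0 (le_trans _ (norm_sqd (refl l c) x))//.
  rewrite lerXn2r ?nnegrE ?divr_ge0 ?(ltW r10)//.
  rewrite (le_trans _ (norm_coord _ l))// !mxE eqxx opprK.
  have r1c : r1 <= c 0 l by rewrite ge_min lexx orbT.
  have xc : 0 <= x 0 l + c 0 l by rewrite addr_ge0// ltW.
  rewrite ger0_norm//; move: xl r1c r10; rewrite /is_true.
  by move: (x 0 l) (c 0 l) => y z; lra.
rewrite KfE rf0 [0 ^+ _]expr0n subr0.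
have rho0 := rho_ge0 c s x.
have wle : 0 < rho c s x -> w i x <= w i c / 2.
  rewrite /rho lt_max ltxx orbF subr_gt0 => xs.
  have : `|w i c - w i x| < - w i c / 2.
    apply: rw; rewrite -ball_normE /= distrC.
    have : `|x - c| < r1 / 2.
      rewrite -(@ltr_pXn2r _ 2%N)// ?nnegrE ?divr_ge0 ?(ltW r10)//.
      exact: le_lt_trans (norm_sqd c x) xs.
    have : r1 <= r by rewrite ge_min lexx.
    by move: r10; lra.
  by rewrite ltr_norml => /andP[]; lra.
have [cx|/(cube_ind_neq0 (ltW e0)) xe] := eqVneq (cube_ind c e x) 0.
  rewrite cx mulr0; have [rz|rz] := eqVneq (rho c s x) 0.
    by rewrite rz expr0n /= mulr0.
  rewrite mulr_le0_ge0 ?exprn_ge0// (le_trans (wle _)) ?lt_neqAle ?rho0 1?eq_sym ?rz//.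
  by move: wc; lra.
have rs : s / 2 <= rho c s x.
  rewrite /rho le_max; apply/orP; left.
  suff : sqd c x <= s / 2 by lra.
  have e1 : e <= 1 by rewrite !ge_min lexx.
  have es : e <= s / (2 * n.+1%:R) by rewrite ge_min lexx orbT.
  apply: (@le_trans _ _ (\sum_(j < n) e)).
    apply: ler_sum => j _; have := le_trans (norm_coord (x - c) j) xe.
    rewrite !mxE => xj; rewrite -real_normK ?num_real// expr2.
    by rewrite -[leRHS]mulr1 ler_pM// (le_trans xj).
  rewrite sumr_const card_ord -[leLHS]mulr_natr.
  rewrite (le_trans (ler_wpM2r (ler0n _ n) es))//.
  have E (a b d : R) : d != 0 -> a / (2 * d) * b = a / 2 * (b / d).
    by move=> d0; field.
  rewrite E ?pnatr_eq0//; apply: ler_piMr; first by rewrite divr_ge0// ltW.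
  by rewrite ler_pdivrMr// mul1r ler_nat.
have rp : 0 < rho c s x by apply: lt_le_trans rs; rewrite divr_gt0.
have wxc : w i x <= w i c / 2 by exact: wle.
have rk : (s / 2) ^+ (k.+3 + i) <= rho c s x ^+ (k.+3 + i).
  by rewrite lerXn2r ?nnegrE ?divr_ge0 ?(ltW s0).
apply: (@le_trans _ _ (- q)); last first.
  by rewrite -[leLHS]mulr1 ler_wnM2l// oppr_le0 ltW.
have -> : - q = - ((- w i c / 2) * (s / 2) ^+ (k.+3 + i)) by [].
rewrite lerNr -mulNr ler_pM//; first by rewrite divr_ge0// oppr_ge0 ltW.
  by rewrite exprn_ge0// divr_ge0// ltW.
by lra.
Qed.

End IteratedMeans.

(** * Regularity up to the boundary *)

Section NavierProblem.
Context {R : realType} {n : nat}.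
Local Notation V := 'rV[R]_n.
Implicit Types (f g u : V -> R) (U : set V) (s : seq 'I_n) (x : V).

Lemma cvg_sumr (T : Type) (F : set_system T) (f : 'I_n -> T -> R) (a : 'I_n -> R) :
  Filter F -> (forall i, f i @ F --> a i) ->
  (fun t => \sum_i f i t) @ F --> \sum_i a i.
Proof.
by move=> FF fa; apply: cvg_big => //; exact: add_continuous.
Qed.

Lemma Ck_le k k' U f : (k <= k')%N -> Ck k' U f -> Ck k U f.
Proof.
move=> kk' [fd fc]; split => [s i x sk|s x sk]; first exact: fd (leq_trans sk kk').
exact: fc (leq_trans sk kk').
Qed.

Lemma Ck_C2 U f : Ck 2 U f ->
  C2 U f (fun j => partial j f) (fun j => partials [:: j; j] f).
Proof.
move=> [fd fc] x Ux; split => [|j|j|j|j].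
- exact: (fc [::]).
- exact: (fc [:: j]).
- exact: (fc [:: j; j]).
- exact/derivableP/(fd [::]).
- exact/derivableP/(fd [:: j]).
Qed.

Lemma near_open U (P : V -> Prop) x : open U -> U x -> (forall y, U y -> P y) ->
  \forall y \near x, P y.
Proof. by move=> oU Ux UP; have := open_nbhs_nbhs (conj oU Ux); apply: filterS. Qed.

Lemma is_derive_partials_lap k U f s j x : open U -> Ck k.+2 U f -> (size s < k)%N -> U x ->
  is_derive x (delta_mx 0 j) (fun x => - \sum_i partials (s ++ [:: i; i]) f x)
    (- \sum_i partials (j :: s ++ [:: i; i]) f x).
Proof.
move=> oU [fd fc] sk Ux.
have D i : is_derive x (delta_mx 0 j) (partials (s ++ [:: i; i]) f)
    (partials (j :: s ++ [:: i; i]) f x).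
  apply: derivableP; apply: fd => //; rewrite size_cat /= addn2.
  exact: sk.
have := is_deriveN (is_derive_sum D).
suff -> : (fun x => - \sum_i partials (s ++ [:: i; i]) f x) =
  - \sum_i partials (s ++ [:: i; i]) f by [].
by apply/funext => y; rewrite /GRing.opp /= fct_sumE.
Qed.

(** The head of the list is the outermost derivative, so a Laplacian appends [i; i] at the end and
    no derivatives are interchanged. Openness of U lets an identity on U be differentiated. *)
Lemma partials_neg_laplacian k U f s x : open U -> Ck k.+2 U f -> (size s <= k)%N -> U x ->
  partials s (@neg_laplacian R n f) x = - \sum_i partials (s ++ [:: i; i]) f x.
Proof.
move=> oU Cf; elim: s x => [//|j s IH] x sk Ux.
have [_ <-] := is_derive_partials_lap j oU Cf sk Ux.
by apply: near_eq_derive; apply: (near_open oU Ux) => y; apply: IH; exact: ltnW.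
Qed.

Lemma Ck_neg_laplacian k U f : open U -> Ck k.+2 U f -> Ck k U (@neg_laplacian R n f).
Proof.
move=> oU Cf; split => [s j x sk Ux|s x sk Ux].
  have [d _] := is_derive_partials_lap j oU Cf sk Ux.
  apply: near_eq_derivable d; apply: (near_open oU Ux) => y Uy.
  by rewrite (partials_neg_laplacian oU Cf (ltnW sk) Uy).
have E : \forall y \near x, - \sum_i partials (s ++ [:: i; i]) f y =
    partials s (@neg_laplacian R n f) y.
  apply: (near_open oU Ux) => y Uy.
  by rewrite (partials_neg_laplacian oU Cf sk Uy).
apply: cvg_trans; first exact: near_eq_cvg E.
rewrite (partials_neg_laplacian oU Cf sk Ux); apply: cvgN.
apply: cvg_sumr => i; have [_ fc] := Cf; apply: fc => //.
by rewrite size_cat /= addn2.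
Qed.

Lemma Ck_iter k i U f : open U -> Ck (k + i.*2) U f -> Ck k U (iter i (@neg_laplacian R n) f).
Proof.
move=> oU; elim: i k => [|i IH] k; first by rewrite addn0.
by rewrite doubleS -!addSnnS => /IH; exact: Ck_neg_laplacian.
Qed.

Definition extends U f := exists g, {within closure U, continuous g} /\ {in U, g =1 f}.

(** Stated for all partials so that the induction closes: each Laplacian spends two of the k
    available orders. *)
Lemma extends_iter k U u : open U -> Ck k U u ->
  (forall s, (size s <= k)%N -> extends U (partials s u)) ->
  forall i s, (size s + i.*2 <= k)%N ->
  extends U (partials s (iter i (@neg_laplacian R n) u)).
Proof.
move=> oU Cu Eu; elim=> [|i IH] s; first by rewrite addn0; exact: Eu.
rewrite doubleS => sk.
have {}IH j : extends U (partials (s ++ [:: j; j]) (iter i (@neg_laplacian R n) u)).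
  by apply: IH; rewrite size_cat /=; lia.
pose g j := sval (cid (IH j)).
have gP j : {within closure U, continuous (g j)} /\
    {in U, g j =1 partials (s ++ [:: j; j]) (iter i (@neg_laplacian R n) u)}.
  exact: svalP (cid (IH j)).
have Ci : Ck (size s).+2 U (iter i (@neg_laplacian R n) u).
  by apply: Ck_iter => //; apply: Ck_le Cu; lia.
exists (fun x => - \sum_j g j x); split.
  apply/subspace_continuousP => x Ux; apply: cvgN; apply: cvg_sumr => j.
  by have [/subspace_continuousP gc _] := gP j; exact: gc.
move=> x /set_mem Ux; rewrite (partials_neg_laplacian oU Ci)//; congr (- _).
by apply: eq_bigr => j _; have [_ ->] := gP j; rewrite ?inE.
Qed.

Lemma enorm_ge_norm x : `|x| <= enorm x.
Proof.
apply: norm_le_coord => [|j]; first exact: sqrtr_ge0.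
rewrite -sqrtr_sqr ler_wsqrtr// (bigD1 j)//= lerDl.
by apply: sumr_ge0 => i _; exact: sqr_ge0.
Qed.

Lemma enorm_le_norm x : enorm x <= n%:R * `|x|.
Proof.
have x0 : 0 <= n%:R * `|x| by rewrite mulr_ge0.
rewrite -(ger0_norm x0) -sqrtr_sqr ler_wsqrtr//.
apply: (@le_trans _ _ (\sum_(i < n) `|x| ^+ 2)).
  apply: ler_sum => i _; rewrite -real_normK ?num_real// lerXn2r ?nnegrE//.
  exact: norm_coord.
rewrite sumr_const card_ord -[leLHS]mulr_natl exprMn ler_wpM2r ?exprn_ge0//.
have nn q : (q <= q ^ 2)%N by case: q => // q; rewrite -mulnn leq_pmulr.
by rewrite -natrX ler_nat nn.
Qed.

(** * Boundary behaviour of continuously extendable functions *)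

Section Boundary.
Variable l : 'I_n.
Local Notation H := [set x : V | 0 < x 0 l].

Lemma closure_half_space x : 0 <= x 0 l -> closure H x.
Proof.
move=> x0 B /nbhs_ballP[r /= r0 rB].
exists (x + (r / 2) *: delta_mx 0 l); split.
  by rewrite /= !mxE !eqxx mulr1 ltr_wpDl// divr_gt0.
apply: rB; rewrite -ball_normE /= opprD addNKr normrN.
apply: (@le_lt_trans _ _ (r / 2)); last lra.
have r20 : 0 <= r / 2 by lra.
apply: norm_le_coord => // j; rewrite !mxE eqxx /= normrM normr_nat (ger0_norm r20).
by rewrite -[leRHS]mulr1 ler_wpM2l// lern1 leq_b1.
Qed.

Lemma closure_ext_boundary f g x : {within closure H, continuous g} ->
  {in H, g =1 f} -> closure H x -> ~ H x -> closure_ext H f x = g x.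
Proof.
move=> gc gf Hx nHx; rewrite /closure_ext memNset//.
have PF : ProperFilter (within H (nbhs x)) by exact: within_nbhs_proper.
have gx := (@subspace_continuousP _ _ _ _).1 gc x Hx.
have sub : g @ within H (nbhs x) --> g @ within (closure H) (nbhs x).
  by move=> A; apply: within_subset; exact: subset_closure.
have fg : f @ within H (nbhs x) --> g @ within H (nbhs x).
  by apply: fmap_within_eq => y Hy; rewrite gf.
by apply/cvg_lim => //; exact: cvg_trans fg (cvg_trans sub gx).
Qed.

Lemma extends_bounded f (L : R) : extends H f ->
  exists2 C : R, 0 <= C & forall x, 0 < x 0 l -> `|x| <= L -> `|f x| <= C.
Proof.
move=> [g [gc gf]].
have cA : compact (closure H `&` [set x : V | `|x| <= L]).
  apply: (subclosed_compact _ (@compact_norm_le R n L) (@subIsetr _ _ _)).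
  by apply: closedI; [exact: closed_closure|exact: closed_norm_le].
have [[x0 Ax0]|A0] := pselect ((closure H `&` [set x : V | `|x| <= L]) !=set0).
  have [|c _ cmax] := @EVT_max_rV R n (fun x => `|g x|) _ (ex_intro _ x0 Ax0) cA.
    apply/subspace_continuousP => x [Hx _].
    apply: (@cvg_comp _ _ _ g (@Num.norm R R)); last exact: norm_continuous.
    have gx := (@subspace_continuousP _ _ _ _).1 gc x Hx.
    by apply: cvg_trans gx => A; apply: within_subset; exact: subIsetl.
  exists `|g c| => // x xl xL; rewrite -gf ?inE//.
  by apply: cmax; rewrite inE; split => //; apply: closure_half_space; exact: ltW.
exists 0 => // x xl xL; exfalso; apply: A0; exists x; split => //.
by apply: closure_half_space; exact: ltW.
Qed.

(** The extension vanishes on the flat boundary; compactness of the boundary part in the ball makes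
    its smallness uniform in height. *)
Lemma extends_boundary f (L eta : R) : extends H f ->
  (forall x, boundary H x -> closure_ext H f x = 0) -> 0 < eta ->
  exists2 e : R, 0 < e &
    forall x, 0 < x 0 l -> x 0 l <= e -> `|x| <= L -> `|f x| <= eta.
Proof.
move=> [g [gc gf]] f0 eta0.
have g0 x : x 0 l = 0 -> g x = 0.
  move=> x0; rewrite -(closure_ext_boundary gc gf).
  - apply: f0; split; first by apply: closure_half_space; rewrite x0.
    by move=> /interior_subset /=; rewrite x0 ltxx.
  - by apply: closure_half_space; rewrite x0.
  - by rewrite /= x0 ltxx.
have cK : compact [set x : V | x 0 l = 0 /\ `|x| <= L].
  apply: (subclosed_compact _ (@compact_norm_le R n L)); last by move=> x [].
  rewrite (_ : mkset _ = ((fun x : V => x 0 l) @^-1` [set 0]) `&` [set x : V | `|x| <= L])//.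
  apply: closedI; last exact: closed_norm_le.
  by apply: closed_comp => [x _|]; [exact: coord_continuous|exact: closed_eq].
have [|e /= e0 He] := (compact_near_coveringP _).1 cK R 0^'+
  (fun e x => forall y : V, 0 < y 0 l -> `|x - y| <= e -> `|f y| <= eta) _ _.
  move=> x [x0 xL].
  have Hx : closure H x by apply: closure_half_space; rewrite x0.
  have gx : g @ within (closure H) (nbhs x) --> g x.
    exact: ((@subspace_continuousP _ _ _ _).1 gc x Hx).
  have /cvgrPdist_le /(_ eta eta0) /nbhs_ballP[r /= r0 rg] := gx.
  exists (ball x (r / 2), [set d | d < r / 2]).
    split; first by apply: nbhsx_ballx; rewrite divr_gt0.
    by apply: nbhs_right_lt; rewrite divr_gt0.
  move=> [y d] /= [xy dr] z zl yz.
  rewrite -gf ?inE// -normrN -[- _]add0r -(g0 x x0); apply: rg.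
    rewrite -ball_normE /=; move: xy; rewrite -ball_normE /= => xy.
    by rewrite (le_lt_trans (ler_distD y _ _))//; lra.
  by apply: closure_half_space; exact: ltW.
have e2 : 0 < e / 2 by rewrite divr_gt0.
exists (e / 2) => // y yl ye yL.
(* The foot of y on the boundary, at distance y_l <= e / 2. *)
pose x : V := \row_j if j == l then 0 else y 0 j.
apply: (He (e / 2) _ _ x) => //=.
- by rewrite sub0r normrN gtr0_norm//; lra.
- split; first by rewrite /x mxE eqxx.
  apply: norm_le_coord => [|j]; first exact: le_trans (normr_ge0 _) yL.
  rewrite mxE; case: ifP => _; last exact: le_trans (norm_coord y j) yL.
  by rewrite normr0 (le_trans (normr_ge0 y)).
apply: norm_le_coord => [|j]; first exact: ltW.
rewrite !mxE; case: eqP => [->|_]; last by rewrite subrr normr0 ltW.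
by rewrite sub0r normrN gtr0_norm.
Qed.

End Boundary.

End NavierProblem.

(** Since the Euclidean norm is at least 1 and a > -n, the weight is at least the power -n of that
    norm, which is at most n (|c| + 1) sqrt s; and (sqrt s)^n = s^m. *)
Lemma powR_weight_ge (R : realType) (n m : nat) (a p : R) (c x : 'rV[R]_n) (s v : R) :
  n = m.*2 -> (0 < n)%N -> - n%:R < a -> 1 <= s -> 1 <= `|x| -> `|x| <= `|c| + Num.sqrt s ->
  ((n%:R * (`|c| + 1)) ^+ n)^-1 / s ^+ m * v `^ p <= enorm x `^ a * v `^ p.
Proof.
move=> nm n0 an s1 x1 xL; rewrite ler_wpM2r ?powR_ge0//.
have z1 : 1 <= enorm x by exact: le_trans (enorm_ge_norm x).
have z0 : 0 < enorm x := lt_le_trans ltr01 z1.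
apply: (@le_trans _ _ (enorm x `^ (- n%:R))); last by rewrite ler_powR// ltW.
rewrite powRN powR_mulrn ?(ltW z0)// -invfM lef_pV2 ?posrE ?mulr_gt0 ?exprn_gt0//; last 2 first.
- by rewrite mulr_gt0 ?ltr0n// ltr_wpDl.
- exact: lt_le_trans s1.
have sq1 : 1 <= Num.sqrt s by rewrite -sqrtr1 ler_wsqrtr.
have s0 : 0 <= s := le_trans ler01 s1.
have <- : Num.sqrt s ^+ n = s ^+ m by rewrite nm -mul2n exprM sqr_sqrtr.
have q0 : 0 <= n%:R * (`|c| + 1) * Num.sqrt s.
  by apply: mulr_ge0 (sqrtr_ge0 s); apply: mulr_ge0 => //; exact: addr_ge0.
rewrite -exprMn lerXn2r ?nnegrE ?(ltW z0)//.
rewrite (le_trans (enorm_le_norm x))// -mulrA ler_wpM2l// (le_trans xL)//.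
by rewrite mulrDl mul1r lerD2r ler_peMr.
Qed.

Theorem theorem1p2 (R : realType) (n : nat) (a p : R) (u : 'rV[R]_n -> R)
  (n_ge4 : (4 <= n)%N) (n_even : ~~ odd n)
  (a_gt : - n%:R < a) (p_gt1 : 1 < p)
  (u_Cn : Ck n (upper_half_space R n) u)
  (u_Cn2 : Ck_closure (n - 2) (upper_half_space R n) u)
  (u_ge0 : forall x, upper_half_space R n x -> 0 <= u x)
  (u_eq : forall x, upper_half_space R n x ->
     iter n./2 (@neg_laplacian R n) u x = enorm x `^ a * u x `^ p)
  (u_bd : forall (i : nat) x, (i <= n./2 - 1)%N ->
     boundary (upper_half_space R n) x ->
     closure_ext (upper_half_space R n) (iter i (@neg_laplacian R n) u) x = 0)
  (u_or : - 2 * p - 2 <= a \/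
     u =o_ (within (upper_half_space R n) (at_infinity R n))
       (fun x => enorm x ^+ 2)) :
  forall (i : nat) (x : 'rV[R]_n), (1 <= i <= n./2 - 1)%N ->
    closure (upper_half_space R n) x ->
    0 <= closure_ext (upper_half_space R n) (iter i (@neg_laplacian R n) u) x.
Proof.
have n0 : (0 < n)%N by apply: leq_trans n_ge4.
have nm : n = n./2.*2 by rewrite even_halfK.
pose m := n./2; rewrite -/m in nm u_eq u_bd *.
have m2 : (1 < m)%N by rewrite /m; case: (n) n_ge4 => [|[|[|[|]]]].
have [l ln] : exists l : 'I_n, l.+1 = n.
  have ln : (n.-1 < n)%N by rewrite prednK.
  by exists (Ordinal ln); rewrite /= prednK.
have UE : upper_half_space R n = [set x | 0 < x 0 l].
  apply/seteqP; split => x /= xP; first exact: xP.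
  by move=> i i1; have -> : i = l by apply/ord_inj/succn_inj; rewrite i1 ln.
rewrite UE in u_Cn u_Cn2 u_ge0 u_eq u_bd *.
have oH := @open_coord_gt R n l 0.
pose w i := iter i (@neg_laplacian R n) u.
have w_Ck i : (i < m)%N -> Ck 2 [set x : 'rV[R]_n | 0 < x 0 l] (w i).
  move=> im; apply: Ck_iter => //; apply: Ck_le u_Cn.
  by rewrite [leqRHS]nm add2n -doubleS leq_double.
have w_ext i : (i < m)%N -> extends [set x : 'rV[R]_n | 0 < x 0 l] (w i).
  move=> im; have [_ C E] := u_Cn2.
  apply: (extends_iter oH C E (s := [::])) => /=.
  (* The budget is tight: 2 i <= 2 (m - 1) = n - 2. *)
  rewrite [leqRHS](_ : _ = m.-1.*2); first by rewrite leq_double; lia.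
  by lia.
have w_bd i x : (i < m)%N -> boundary [set x : 'rV[R]_n | 0 < x 0 l] x ->
    closure_ext [set x : 'rV[R]_n | 0 < x 0 l] (w i) x = 0.
  by move=> im; apply: u_bd; rewrite subn1; lia.
have w_ge0 i (x : 'rV[R]_n) : (0 < i < m)%N -> 0 < x 0 l -> 0 <= w i x.
  move=> im xl.
  (* The kernels are centred at the point x itself, and the weight constant depends on it. *)
  apply: (@iterated_ge0 R n m nm l w _ _ (fun i im => Ck_C2 (w_Ck i im)) _ _ _ x xl _ _ p
    ((n%:R * (`|x| + 1)) ^+ n)^-1) => //.
  - by move=> j L jm; exact: extends_bounded (w_ext j jm).
  - move=> j L eta jm eta0; apply: extends_boundary (w_ext j jm) _ eta0.
    by move=> y; exact: w_bd.
  - by move=> y yl; rewrite /w u_eq// mulr_ge0 ?powR_ge0.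
  - by rewrite invr_gt0 exprn_gt0// mulr_gt0 ?ltr0n// ltr_wpDl.
  - move=> s y s1 yl y1 yL; rewrite /w u_eq//.
    exact: powR_weight_ge.
move=> i x im Hx; have im' : (0 < i < m)%N by lia.
have [xH|xH] := pselect ([set x : 'rV[R]_n | 0 < x 0 l] x).
  by rewrite /closure_ext mem_set//; exact: w_ge0.
(* Elsewhere in the closure the boundary condition gives the value 0. *)
rewrite w_bd//; first by case/andP: im'.
by split => // /interior_subset.
Qed.
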